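(* Let $\mathcal{H}$ be a Hilbert space, $B\in L(\mathcal{H})^s$ and let $\mathcal{S}$ be a closed subspace of $\mathcal{H}$. Suppose that $\mathcal{S}=\mathcal{S}_+\oplus_B\mathcal{S}_-$ is any decomposition with $\mathcal{S}_\pm$ closed, $\mathcal{S}_+$ $B$-nonnegative and $\mathcal{S}_-$ $B$-nonpositive. Then $B$ is $\mathcal{S}$-weakly complementable if and only if there exist $\min \mathcal{M}^{+}(\max \mathcal{M}^{-}(B,\mathcal{S}_+^{\perp}),\mathcal{S}_-^{\perp})$ and $\max \mathcal{M}^{-}(\min \mathcal{M}^{+}(B,\mathcal{S}_-^{\perp}),\mathcal{S}_+^{\perp})$. In this case, $$B_{/\mathcal{S}}=\min \mathcal{M}^{+}(\max \mathcal{M}^{-}(B,\mathcal{S}_+^{\perp}),\mathcal{S}_-^{\perp})=\max \mathcal{M}^{-}(\min \mathcal{M}^{+}(B,\mathcal{S}_-^{\perp}),\mathcal{S}_+^{\perp}).$$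
   Context: Hilbert spaces are complex and separable. $L(\mathcal{H})$ is the algebra of bounded operators on $\mathcal{H}$, $L(\mathcal{H})^s$ the set of selfadjoint ones, $L(\mathcal{H})^+$ the cone of positive semidefinite ones; $T\leq_{\mathcal{H}}S$ means $S-T\in L(\mathcal{H})^+$. $R(\cdot)$, $N(\cdot)$ denote range and nullspace, and $|T|=(T^*T)^{1/2}$. For $B\in L(\mathcal{H})^s$, a subspace $\mathcal{S}$ is $B$-nonnegative (resp. $B$-nonpositive) if $\langle Bs,s\rangle\ge 0$ (resp. $\le 0$) for all $s\in\mathcal{S}$. The notation $\mathcal{S}_+\oplus_B\mathcal{S}_-$ is the orthogonal direct sum of $\mathcal S_+$ and $\mathcal S_-$ when, in addition, $\langle Bs,t\rangle=0$ for all $s\in\mathcal{S}_+$, $t\in\mathcal{S}_-$. (Such decompositions of a closed subspace $\mathcal S$ always exist.) For a closed subspace $\mathcal{S}$, write $B=\begin{pmatrix} a & b\\ b^* & c\end{pmatrix}$ with respect to $\mathcal{H}=\mathcal{S}\oplus\mathcal{S}^\perp$. $B$ is $\mathcal{S}$-weakly complementable if $R(b)\subseteq R(|a|^{1/2})$. In that case let $f\in L(\mathcal{S}^\perp,\mathcal{S})$ be the reduced solution of $b=|a|^{1/2}x$, i.e. the unique $f$ with $b=|a|^{1/2}f$, $N(f)=N(b)$ and $R(f)\subseteq\overline{R(|a|^{1/2})}$, and let $a=u|a|$ be the polar decomposition ($u$ a partial isometry with $N(u)=N(a)$). The Schur complement of $B$ to $\mathcal{S}$ is $B_{/\mathcal{S}}:=\begin{pmatrix}0&0\\0&c-f^*uf\end{pmatrix}$.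 For a closed subspace $\mathcal{T}$ and $C\in L(\mathcal{H})^s$, $\mathcal{M}^{-}(C,\mathcal{T}^\perp):=\{X\in L(\mathcal{H})^s: X\leq_{\mathcal{H}}C,\ R(X)\subseteq\mathcal{T}^\perp\}$ and $\mathcal{M}^{+}(C,\mathcal{T}^\perp):=\{X\in L(\mathcal{H})^s: C\leq_{\mathcal{H}}X,\ R(X)\subseteq\mathcal{T}^\perp\}$. $\max$ and $\min$ denote the maximum and minimum elements with respect to $\leq_{\mathcal{H}}$. Existence of a nested expression such as $\min \mathcal{M}^{+}(\max \mathcal{M}^{-}(B,\mathcal{S}_+^{\perp}),\mathcal{S}_-^{\perp})$ means that the inner maximum $C$ exists and that $\mathcal{M}^{+}(C,\mathcal{S}_-^\perp)$ has a minimum element. *)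

(* Defs.v *)
From HB Require Import structures.
From mathcomp Require Import all_boot all_order all_algebra sesquilinear complex.
From mathcomp Require Import all_classical all_reals all_analysis.

Set Implicit Arguments.
Unset Strict Implicit.
Unset Printing Implicit Defensive.

Import Order.TTheory GRing.Theory Num.Theory.
Import numFieldNormedType.Exports.

Local Open Scope classical_set_scope.
Local Open Scope ring_scope.
Local Open Scope complex_scope.

(* The inner product is linear in its first argument and conjugate-linear in
   its second one, and it induces the norm. *)
HB.mixin Record CompleteNormedModule_isHilbert (R : realType) H
    & CompleteNormedModule R[i] H := {
  inner : {dot H for Num.conj} ;
  inner_norm : forall x : H, inner x x = `|x| ^+ 2
}.

#[short(type="hilbertType")]
HB.structure Definition Hilbert (R : realType) :=
  {H of CompleteNormedModule R[i] H & CompleteNormedModule_isHilbert R H}.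

Notation "'[ x , y ]" := (inner x y)
  (at level 0, format "''[' x ,  y ]").

Definition separable_space (T : topologicalType) :=
  exists2 D : set T, countable D & dense D.

(* Operators are plain functions H -> H, so that equality of operators is
   equality of functions and L(H) is the predicate bounded_op.  Objects that
   are characterized by a unique existence property (adjoint, square root, ...)
   are picked with xget, and are the zero map when nothing has the property. *)
Section Operators.
Variables (R : realType) (H : hilbertType R).
Implicit Types (S T N : set H) (A B C X Y Q : H -> H) (M : set (H -> H)).

Definition the_op M : H -> H := xget (fun=> 0) M.

Definition closed_subspace S :=
  [/\ closed S, S 0 & forall (k : R[i]) x y, S x -> S y -> S (k *: x + y)].

Definition orthocomp S : set H := [set x | forall s, S s -> '[x, s] = 0].

Definition bounded_op A :=
  linear A /\ exists M : R, forall x, `|A x| <= M%:C * `|x|.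

Definition is_adjoint A A' := forall x y, '[A x, y] = '[x, A' y].

Definition adjoint A := the_op [set A' | bounded_op A' /\ is_adjoint A A'].

Definition selfadjoint A := bounded_op A /\ is_adjoint A A.

(* 0 <= z in R[i] means that z is real and nonnegative. *)
Definition psd A := bounded_op A /\ forall x, 0 <= '[A x, x].

Definition op_le A B := psd (B \- A).

Definition nullspace A : set H := A @^-1` [set 0].

Definition op_sqrt A := the_op [set Q | psd Q /\ Q \o Q = A].

Definition op_abs A := op_sqrt (adjoint A \o A).

Definition partial_isometry A :=
  bounded_op A /\ forall x, orthocomp (nullspace A) x -> `|A x| = `|x|.

Definition polar A :=
  the_op [set U | [/\ partial_isometry U, A = U \o op_abs A
                  & nullspace U = nullspace A]].

(* The reduced solution of B = A x. *)
Definition reduced_solution A B :=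
  the_op [set F | [/\ bounded_op F, B = A \o F, nullspace F = nullspace B
                  & range F `<=` closure (range A)]].

Definition orthoproj S :=
  the_op [set P | bounded_op P /\ forall x, S (P x) /\ orthocomp S (x - P x)].

(* The entries a, b and c of B with respect to H = S (+) S^perp.  An operator
   between S and S^perp is represented by its extension by 0 to H.  This changes
   neither its range nor the other constructions above: |a|, its square root,
   the polar factor u and the reduced solution f of the extended entries are
   the extensions by 0 of those of the original entries. *)
Definition block_a S B := orthoproj S \o B \o orthoproj S.
Definition block_b S B := orthoproj S \o B \o (id \- orthoproj S).
Definition block_c S B := (id \- orthoproj S) \o B \o (id \- orthoproj S).

Definition weakly_complementable S B :=
  range (block_b S B) `<=` range (op_sqrt (op_abs (block_a S B))).

Definition schur S B : H -> H :=
  let a := block_a S B in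
  let f := reduced_solution (op_sqrt (op_abs a)) (block_b S B) in
  block_c S B \- (adjoint f \o polar a \o f).

Definition nonnegative_on B S := forall s, S s -> 0 <= '[B s, s].
Definition nonpositive_on B S := forall s, S s -> '[B s, s] <= 0.

(* S is the orthogonal and B-orthogonal direct sum of S1 and S2; the sum is
   direct because it is orthogonal. *)
Definition orthogonal_sum B S S1 S2 :=
  [/\ S = [set s + t | s in S1 & t in S2],
      forall s t, S1 s -> S2 t -> '[s, t] = 0
    & forall s t, S1 s -> S2 t -> '[B s, t] = 0].

Definition Mminus C N : set (H -> H) :=
  [set X | [/\ selfadjoint X, op_le X C & range X `<=` N]].
Definition Mplus C N : set (H -> H) :=
  [set X | [/\ selfadjoint X, op_le C X & range X `<=` N]].

Definition is_max M X := M X /\ forall Y, M Y -> op_le Y X.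
Definition is_min M X := M X /\ forall Y, M Y -> op_le X Y.

Definition has_max M := exists X, is_max M X.
Definition has_min M := exists X, is_min M X.

Definition op_max M := the_op [set X | is_max M X].
Definition op_min M := the_op [set X | is_min M X].

End Operators.

(* Main.v *)
Require Import Defs.
From HB Require Import structures.
From mathcomp Require Import all_boot all_order all_algebra sesquilinear complex.
From mathcomp Require Import all_classical all_reals all_analysis.
From mathcomp Require Import ring lra.

Set Implicit Arguments.
Unset Strict Implicit.
Unset Printing Implicit Defensive.

Import Order.TTheory GRing.Theory Num.Theory.
Import numFieldNormedType.Exports.

Local Open Scope classical_set_scope.
Local Open Scope ring_scope.

(** With [J = P+ - P-] and [a] the compression of [B] to [S], one has [|a| = J a], and
    [G = |a|^(1/2)] commutes with the projections [P+] and [P-].  If [b = G f], then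
    [Sigma = c - f* u f] satisfies
      [<B x, x> = <Sigma x, x> + |L1 x|^2 - |L2 x|^2],
    where [L1 = P+ (G + f)] and [L2 = P- (G - f)].  Each [L1 x] (resp. [L2 x]) can be made
    arbitrarily small by moving [x] along [S+] (resp. [S-]), which does not change
    [<X x, x>] for a selfadjoint [X] with range in the orthogonal complement.  Hence
    [C1 = Sigma - L2* L2] is the maximum of M-(B, S+^perp), [C2 = Sigma + L1* L1] is the
    minimum of M+(B, S-^perp), and [Sigma] is extremal for both.  Conversely, for [X] in
    M-(B, S+^perp) the Cauchy-Schwarz inequality for the form of [B - X] bounds [P+ b] by
    [G], and likewise for S-, so [R(b)] lies in [R(G)] by Douglas' criterion. *)

(** * The real inner product and norm underlying the complex ones *)

Section RealInnerProduct.
Variables (R : realType) (H : hilbertType R).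
Implicit Types (x y z : H) (r : R) (A : H -> H).

(** B-orthogonality makes [a] block diagonal along S+ and S-, with a nonnegative and a nonpositive
    block; flipping the sign of the second block gives a positive operator with the same square,
    hence |a|. [L1] and [L2] come from completing the square on each summand: on S+ the form of [a]
    is |G x|^2 and asks for [f] with a plus sign, on S- it is -|G x|^2 and asks for a minus sign.
    The terms added in doing so amount to <u f x, f x>, which Sigma takes away. Two obstacles shape
    the argument. The vector [f x] lies in the closure of R(G), perhaps not in R(G), so the infimum
    of |L1| along S+ need not be attained and extremality goes through approximation. And [J] need
    not be the polar factor u, because it need not vanish on N(a); it does agree with u on the
    closure of R(G), where [f] takes its values. *)

Definition nm x : R := complex.Re `|x|.
(** Real parts move every estimate into the ordered field [R]. Nothing is lost: the norm is real,
    and the imaginary part of an inner product is recovered by multiplying one argument by i. *)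
Definition ip x y : R := complex.Re '[x, y].

Lemma normE x : `|x| = real_complex R (nm x).
Proof. by rewrite /nm RRe_real // ger0_real. Qed.

Lemma nm_ge0 x : 0 <= nm x.
Proof. by rewrite -ler0c -normE. Qed.

Lemma innerC x y : '[x, y] = ('[y, x]^*)%C.
Proof. by rewrite hermC expr0 mul1r. Qed.

Lemma innerZl (k : R[i]) x y : '[k *: x, y] = k * '[x, y].
Proof. by rewrite linearZl_LR. Qed.

Lemma ipC x y : ip x y = ip y x.
Proof. by rewrite /ip innerC; case: '[y, x]. Qed.

Lemma ipDl x y z : ip (x + y) z = ip x z + ip y z.
Proof. by rewrite /ip linearDl raddfD. Qed.

Lemma ipNl x z : ip (- x) z = - ip x z.
Proof. by rewrite /ip linearNl raddfN. Qed.

Lemma ipZl r x z : ip (real_complex R r *: x) z = r * ip x z.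
Proof. by rewrite /ip innerZl; case: '[x, z] => a b /=; rewrite mul0r subr0. Qed.

Lemma ipZr r x z : ip x (real_complex R r *: z) = r * ip x z.
Proof. by rewrite ipC ipZl ipC. Qed.

Lemma ipDr x y z : ip z (x + y) = ip z x + ip z y.
Proof. by rewrite ipC ipDl !(ipC z). Qed.

Lemma ipNr x z : ip z (- x) = - ip z x.
Proof. by rewrite ipC ipNl ipC. Qed.

Lemma ip0l x : ip 0 x = 0.
Proof. by rewrite -(scale0r (0 : H)) -[0 in X in ip X]/(real_complex R 0) ipZl mul0r. Qed.

Lemma ip0r x : ip x 0 = 0.
Proof. by rewrite ipC ip0l. Qed.

Lemma ipBl x y z : ip (x - y) z = ip x z - ip y z.
Proof. by rewrite ipDl ipNl. Qed.

Lemma ipBr x y z : ip z (x - y) = ip z x - ip z y.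
Proof. by rewrite ipDr ipNr. Qed.

Lemma Im_inner x y : complex.Im '[x, y] = - ip ('i%C *: x) y.
Proof.
by rewrite /ip innerZl; case: '[x, y] => a b /=; rewrite mul0r mul1r sub0r opprK.
Qed.

Lemma innerE x y x' y' : ip x y = ip x' y' ->
  ip ('i%C *: x) y = ip ('i%C *: x') y' -> '[x, y] = '[x', y'].
Proof.
move=> h1 h2; apply/eqP; rewrite eq_complex -/(ip x y) -/(ip x' y') h1 eqxx /=.
by rewrite !Im_inner h2.
Qed.

Lemma ip_nm x : ip x x = nm x ^+ 2.
Proof. by rewrite /ip inner_norm normE -rmorphXn. Qed.

Lemma nm_eq0 x : nm x = 0 -> x = 0.
Proof. by move=> h; apply: normr0_eq0; rewrite normE h. Qed.

Lemma nm0 : nm 0 = 0.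
Proof. by rewrite /nm normr0. Qed.

Lemma nmN x : nm (- x) = nm x.
Proof. by rewrite /nm normrN. Qed.

Lemma nmBC x y : nm (x - y) = nm (y - x).
Proof. by rewrite -nmN opprB. Qed.

Lemma nmD x y : nm (x + y) <= nm x + nm y.
Proof. by have := ler_normD x y; rewrite !normE -rmorphD lecR. Qed.

Lemma nm_triangle y x z : nm (x - z) <= nm (x - y) + nm (y - z).
Proof. by have := nmD (x - y) (y - z); rewrite addrA subrK. Qed.

Lemma nmZ r x : nm (real_complex R r *: x) = `|r| * nm x.
Proof.
rewrite /nm normrZ normc_def /= expr0n addr0 sqrtr_sqr.
by case: `|x| => a b /=; rewrite mul0r subr0.
Qed.

Lemma ip_eq0 x : (forall y, ip x y = 0) -> x = 0.
Proof.
move=> /(_ x); rewrite ip_nm => /eqP; rewrite sqrf_eq0 => /eqP; exact: nm_eq0.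
Qed.

Lemma ip_inj x y : (forall z, ip x z = ip y z) -> x = y.
Proof.
by move=> h; apply/eqP; rewrite -subr_eq0; apply/eqP/ip_eq0 => z; rewrite ipBl h subrr.
Qed.

(** The common source of the Cauchy-Schwarz inequalities for the inner product and for positive
    forms, and of the variational estimate behind the Riesz argument. *)
Lemma quad_ge0_discr (a b c : R) : 0 <= a ->
  (forall t, 0 <= a * t ^+ 2 + 2 * b * t + c) -> b ^+ 2 <= a * c.
Proof.
move=> a0 h; have [a_gt0|a_le0] := ltP 0 a.
  have := h (- b / a).
  have -> : a * (- b / a) ^+ 2 + 2 * b * (- b / a) + c = (a * c - b ^+ 2) / a.
    by field; rewrite gt_eqF.
  by rewrite pmulr_lge0 ?invr_gt0 // subr_ge0.
have a00 : a = 0 by apply/eqP; rewrite eq_le a_le0.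
rewrite a00 mul0r.
have [->|b0] := eqVneq b 0; first by rewrite expr0n.
(* With a = 0 the function is affine of slope 2b; at this point it would equal -1. *)
have := h (- (c + 1) / (2 * b)); rewrite a00 mul0r add0r.
have -> : 2 * b * (- (c + 1) / (2 * b)) = - (c + 1) by field.
lra.
Qed.

Lemma ip_CS x y : ip x y <= nm x * nm y.
Proof.
have h : ip x y ^+ 2 <= nm x ^+ 2 * nm y ^+ 2.
  apply: quad_ge0_discr => [|t]; first exact: sqr_ge0.
  have := sqr_ge0 (nm (real_complex R t *: x + y)).
  rewrite -!ip_nm !(ipDl, ipDr) !(ipZl, ipZr) (ipC y x); lra.
have m0 : 0 <= nm x * nm y by rewrite mulr_ge0 ?nm_ge0.
apply: le_trans (ler_norm _) _.
by rewrite -(ler_pXn2r (n := 2)) ?nnegrE // real_normK ?num_real ?exprMn.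
Qed.

Lemma ip_CSabs x y : `|ip x y| <= nm x * nm y.
Proof. by rewrite ler_norml ip_CS andbT lerNl -ipNl (le_trans (ip_CS _ _)) // nmN. Qed.

Lemma nm_sqD x y : nm (x + y) ^+ 2 = nm x ^+ 2 + 2 * ip x y + nm y ^+ 2.
Proof. rewrite -!ip_nm !(ipDl, ipDr) (ipC y x); lra. Qed.

Lemma nm_sqB x y : nm (x - y) ^+ 2 = nm x ^+ 2 - 2 * ip x y + nm y ^+ 2.
Proof. by rewrite nm_sqD ipNr nmN; lra. Qed.

End RealInnerProduct.

(** * Convergence of sequences and closures, expressed with the real norm *)

Section Limits.
Variables (R : realType) (H : hilbertType R).
Implicit Types (x y z : H) (A : H -> H) (S : set H).

Definition limit_of (u : nat -> H) (l : H) :=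
  forall e : R, 0 < e -> exists N, forall n, (N <= n)%N -> nm (u n - l) <= e.

Lemma invS_small (e : R) : 0 < e ->
  exists N, forall n, (N <= n)%N -> n.+1%:R^-1 <= e.
Proof.
move=> e0; exists (Num.truncn e^-1) => n hn.
rewrite -(invrK e) lef_pV2 ?posrE ?invr_gt0 ?ltr0n //.
by rewrite (le_trans (ltW (truncnS_gt _))) // ler_nat ltnS.
Qed.

Lemma le_of_eps (a b c : R) : 0 <= c ->
  (forall e, 0 < e -> a <= b + c * e) -> a <= b.
Proof.
move=> c0 h; apply/ler_addgt0Pr => e e0.
have c1 : 0 < c + 1 by lra.
have := h (e / (c + 1)); rewrite divr_gt0 // => /(_ isT) /le_trans; apply.
by rewrite lerD2l mulrA ler_pdivrMr // mulrC ler_pM2l //; lra.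
Qed.

Lemma closureP S x :
  closure S x <-> forall e : R, 0 < e -> exists2 y, S y & nm (x - y) < e.
Proof.
split=> [h e e0|h B /nbhs_ballP[e /= e0 he]].
  have /h[y [Sy]] : nbhs x (ball x (real_complex R e)).
    by apply: nbhsx_ballx; rewrite ltcR.
  by rewrite -ball_normE /= normE ltcR => hy; exists y.
have er : e = real_complex R (complex.Re e) by rewrite RRe_real // gtr0_real.
have [y Sy hy] : exists2 y, S y & nm (x - y) < complex.Re e.
  by apply: h; rewrite -ltcR -er.
exists y; split => //; apply: he.
by rewrite -ball_normE /= normE er ltcR.
Qed.

Lemma cauchy_limit (u : nat -> H) :
  (forall e : R, 0 < e -> exists N, forall n m, (N <= n)%N -> (N <= m)%N ->
     nm (u n - u m) <= e) ->
  exists l, limit_of u l.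
Proof.
move=> hu.
have : cvg (u @ \oo).
  apply: cauchy_cvg; apply: cauchy_exP => e e0.
  have er : e = real_complex R (complex.Re e) by rewrite RRe_real // gtr0_real.
  have e0' : 0 < complex.Re e by rewrite -ltcR -er.
  have [|N hN] := hu (complex.Re e / 2); first by rewrite divr_gt0.
  exists (u N); exists N => // n /= hn.
  rewrite -ball_normE /= normE er ltcR.
  by rewrite (le_lt_trans (hN _ _ (leqnn _) hn)) //; lra.
rewrite cvg_ex => -[l /cvgrPdist_le hl]; exists l => e e0.
have [|N _ hN] := hl (real_complex R e); first by rewrite ltcR.
by exists N => n hn; rewrite nmBC -lecR -normE; apply: hN.
Qed.

Lemma limit_le_nm (u : nat -> H) l x (c : R) N : limit_of u l ->
  (forall n, (N <= n)%N -> nm (u n - x) <= c) -> nm (l - x) <= c.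
Proof.
move=> ul hu; apply: (@le_of_eps _ _ 1) => // e e0.
have [M hM] := ul e e0.
apply: le_trans (nm_triangle (u (maxn M N)) _ _) _.
rewrite nmBC mul1r addrC lerD ?hM ?hu ?leq_maxl ?leq_maxr //.
Qed.

Lemma limit_unique (u : nat -> H) l l' : limit_of u l -> limit_of u l' -> l = l'.
Proof.
move=> h h'; apply/eqP; rewrite -subr_eq0; apply/eqP/nm_eq0/eqP.
rewrite eq_le nm_ge0 andbT; apply: (@le_of_eps _ _ 1) => // e e0.
have [N hN] := h' e e0; rewrite add0r mul1r; exact: (limit_le_nm h hN).
Qed.

Lemma closure_limit S (u : nat -> H) l :
  limit_of u l -> (forall n, S (u n)) -> closure S l.
Proof.
move=> h hS; apply/closureP => e e0; have [|N hN] := h (e / 2); first by rewrite divr_gt0.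
by exists (u N) => //; rewrite nmBC; have := hN N (leqnn _); lra.
Qed.

End Limits.

(** * Bounded, selfadjoint and positive operators and their order *)

Section BoundedOperators.
Variables (R : realType) (H : hilbertType R).
Implicit Types (x y z : H) (A B C : H -> H) (S : set H).

Lemma bounded_opI A (M : R) : linear A -> (forall x, nm (A x) <= M * nm x) ->
  bounded_op A.
Proof. by move=> lA hM; split=> //; exists M => x; rewrite !normE -rmorphM lecR. Qed.

Lemma bounded_opP A : bounded_op A ->
  exists2 M : R, 0 <= M & forall x, nm (A x) <= M * nm x.
Proof.
move=> [_ [M hM]]; exists (Num.max M 0) => [|x]; first by rewrite le_max lexx orbT.
have := hM x; rewrite !normE -rmorphM lecR => /le_trans; apply.
by rewrite ler_wpM2r ?nm_ge0 // le_max lexx.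
Qed.

Lemma bopD A x y : bounded_op A -> A (x + y) = A x + A y.
Proof. by move=> [/(_ 1 x y)]; rewrite !scale1r. Qed.

Lemma bop0 A : bounded_op A -> A 0 = 0.
Proof. by move=> hA; apply: (addrI (A 0)); rewrite -bopD // !addr0. Qed.

Lemma bopZ A k x : bounded_op A -> A (k *: x) = k *: A x.
Proof. by move=> hA; have := hA.1 k x 0; rewrite !addr0 bop0 // addr0. Qed.

Lemma bopN A x : bounded_op A -> A (- x) = - A x.
Proof. by move=> hA; rewrite -scaleN1r bopZ // scaleN1r. Qed.

Lemma bopB A x y : bounded_op A -> A (x - y) = A x - A y.
Proof. by move=> hA; rewrite bopD // bopN. Qed.

Lemma bounded_comp A B : bounded_op A -> bounded_op B -> bounded_op (A \o B).
Proof.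
move=> hA hB; have [M M0 hM] := bounded_opP hA; have [N N0 hN] := bounded_opP hB.
apply: (@bounded_opI _ (M * N)) => [k x y|x] /=.
  by rewrite (bopD _ _ hB) (bopD _ _ hA) (bopZ _ _ hB) (bopZ _ _ hA).
by rewrite (le_trans (hM _)) // -mulrA ler_wpM2l.
Qed.

Lemma bounded_lincomb k A B : bounded_op A -> bounded_op B ->
  bounded_op (fun x => A x + real_complex R k *: B x).
Proof.
move=> hA hB; have [M M0 hM] := bounded_opP hA; have [N N0 hN] := bounded_opP hB.
apply: (@bounded_opI _ (M + `|k| * N)) => [c x y|x].
  rewrite (bopD _ _ hA) (bopD _ _ hB) (bopZ _ _ hA) (bopZ _ _ hB) !scalerDr !scalerA.
  by rewrite (mulrC _ c) addrACA.
rewrite (le_trans (nmD _ _)) // mulrDl lerD // nmZ -mulrA.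
by rewrite ler_wpM2l.
Qed.

Lemma bounded_add A B : bounded_op A -> bounded_op B -> bounded_op (A \+ B).
Proof.
move=> hA hB; have := bounded_lincomb 1 hA hB.
by congr bounded_op; apply/funext => x; rewrite scale1r.
Qed.

Lemma bounded_sub A B : bounded_op A -> bounded_op B -> bounded_op (A \- B).
Proof.
move=> hA hB; have := bounded_lincomb (-1) hA hB.
by congr bounded_op; apply/funext => x; rewrite rmorphN scaleN1r.
Qed.

Lemma bounded_zero : bounded_op (fun=> 0 : H).
Proof.
apply: (@bounded_opI _ 0) => [k x y|x]; first by rewrite scaler0 addr0.
by rewrite nm0 mul0r.
Qed.

Lemma bounded_id : bounded_op (@id H).
Proof.
by apply: (@bounded_opI _ 1) => [k x y //|x]; rewrite mul1r.
Qed.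

Lemma bounded_scale k A : bounded_op A -> bounded_op (fun x => real_complex R k *: A x).
Proof.
move=> hA; have := bounded_lincomb k bounded_zero hA.
by congr bounded_op; apply/funext => x; rewrite add0r.
Qed.

(** For linear [A] this coincides with [is_adjoint]: replacing x by i x recovers the imaginary
    parts. *)
Definition real_adjoint A B := forall x y, ip (A x) y = ip x (B y).

Lemma adjointE A B : linear A -> is_adjoint A B <-> real_adjoint A B.
Proof.
move=> lA; split=> h x y; first by rewrite /ip h.
have A0 : A 0 = 0.
  by apply: (addrI (A 0)); rewrite -{1}(scale1r (A 0)) -lA scaler0 !addr0.
apply: innerE; first exact: h.
by rewrite -h; have := lA 'i%C x 0; rewrite !addr0 A0 addr0 => ->.
Qed.

Lemma real_adjointC A B : real_adjoint A B -> real_adjoint B A.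
Proof. by move=> h x y; rewrite ipC -h ipC. Qed.

Lemma real_adjoint_linear A B : linear A -> real_adjoint A B -> linear B.
Proof.
move=> lA /(adjointE _ lA) h k x y; apply: ip_inj => z; congr complex.Re.
have hB u : '[B u, z] = '[u, A z] by rewrite innerC -h -innerC.
by rewrite linearDl /= innerZl !hB linearDl /= innerZl.
Qed.

Lemma real_adjoint_unique A B C : real_adjoint A B -> real_adjoint A C -> B = C.
Proof.
move=> h h'; apply/funext => x; apply: ip_inj => z.
by rewrite !(ipC _ z) -h h'.
Qed.

(** |B x|^2 = <A B x, x> <= M |B x| |x|, so [B] inherits the bound of [A]. *)
Lemma bounded_adjoint A B : bounded_op A -> real_adjoint A B -> bounded_op B.
Proof.
move=> hA h; have [M M0 hM] := bounded_opP hA.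
apply: (@bounded_opI _ M) => [|x]; first exact: real_adjoint_linear hA.1 h.
have [->|nx] := eqVneq (nm (B x)) 0.
  by rewrite mulr_ge0 ?nm_ge0.
have p : 0 < nm (B x) by rewrite lt_def nx nm_ge0.
rewrite -(ler_pM2r p) -expr2 -ip_nm -h (le_trans (ip_CS _ _)) //.
by rewrite mulrAC ler_wpM2r ?nm_ge0.
Qed.

Lemma adjointP A B : bounded_op A -> real_adjoint A B -> adjoint A = B.
Proof.
move=> hA h; rewrite /adjoint /the_op; case: xgetP => [C _ [bC aC]|/(_ B)].
  by apply: real_adjoint_unique h; apply/(adjointE _ hA.1).
by case; split; [exact: bounded_adjoint hA h|apply/(adjointE _ hA.1)].
Qed.

Lemma selfadjointE A : selfadjoint A <-> bounded_op A /\ real_adjoint A A.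
Proof. by split=> -[bA h]; split => //; apply/(adjointE _ bA.1). Qed.

Lemma inner_real A x : selfadjoint A -> '[A x, x] = real_complex R (ip (A x) x).
Proof.
move=> [bA sA]; have : '[A x, x] = ('[A x, x]^*)%C by rewrite -innerC sA.
rewrite /ip; case: '[A x, x] => a b [] /= hb.
by congr Complex; lra.
Qed.

(** Over the complex numbers a real quadratic form forces selfadjointness: <A x, x> has no imaginary
    part, and polarizing this at i x + y gives the symmetry of [A]. *)
Lemma psdE A : psd A <-> selfadjoint A /\ forall x, 0 <= ip (A x) x.
Proof.
split=> [[bA pA]|[sA pA]]; last first.
  by split=> [|x]; [exact: sA.1|rewrite inner_real // ler0c].
split=> [|x]; last by have := pA x; rewrite lecE => /andP[].
apply/selfadjointE; split => // x y.
have im x' : ip ('i%C *: A x') x' = 0.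
  have := pA x'; rewrite lecE => /andP[/eqP + _].
  by rewrite Im_inner /= => /eqP; rewrite oppr_eq0 => /eqP.
have iis (a b : H) : ip ('i%C *: a) ('i%C *: b) = ip a b.
  rewrite /ip innerZl innerC innerZl [in RHS]innerC.
  by case: '[b, a] => u v /=; rewrite !mul0r !mul1r; lra.
have key u v : ip ('i%C *: A u) v + ip ('i%C *: A v) u = 0.
  have := im (u + v); rewrite bopD // scalerDr !ipDl !ipDr !im; lra.
have := key ('i%C *: x) y; rewrite bopZ // scalerA.
have -> : 'i%C * 'i%C = -1 :> R[i] by rewrite -expr2 sqr_i.
rewrite scaleN1r ipNl iis (ipC x); lra.
Qed.

Lemma op_leE A B : selfadjoint A -> selfadjoint B ->
  op_le A B <-> forall x, ip (A x) x <= ip (B x) x.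
Proof.
move=> /selfadjointE[bA sA] /selfadjointE[bB sB]; rewrite /op_le; split.
  by move=> /psdE[_ h] x; rewrite -subr_ge0 -ipBl; apply: h.
move=> h; apply/psdE; split=> [|x] /=; last by rewrite ipBl subr_ge0.
apply/selfadjointE; split; first exact: (bounded_sub bB bA).
by move=> x y /=; rewrite ipBl ipBr sA sB.
Qed.

Lemma polarization A : real_adjoint A A -> bounded_op A ->
  (forall x, ip (A x) x = 0) -> forall x, A x = 0.
Proof.
move=> sA bA h x; apply: ip_eq0 => y.
have := h (x + y); rewrite bopD // ipDl !ipDr !h (ipC (A y)) -sA; lra.
Qed.

Lemma op_le_anti A B : selfadjoint A -> selfadjoint B ->
  op_le A B -> op_le B A -> A = B.
Proof.
move=> sA sB /(op_leE sA sB) h1 /(op_leE sB sA) h2.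
move: sA sB => /selfadjointE[bA sA] /selfadjointE[bB sB].
apply/funext => x; apply/eqP; rewrite -subr_eq0; apply/eqP.
apply: (@polarization (A \- B)) => [u v||u] /=; last 2 first.
- exact: bounded_sub.
- by rewrite ipBl; apply/eqP; rewrite subr_eq0 eq_le h1 h2.
by rewrite ipBl ipBr sA sB.
Qed.

Lemma psd_CS A x y : psd A -> ip (A x) y ^+ 2 <= ip (A x) x * ip (A y) y.
Proof.
move=> /psdE[/selfadjointE[bA sA] pA].
apply: quad_ge0_discr => // t.
have := pA (real_complex R t *: x + y).
rewrite bopD // bopZ // !(ipDl, ipDr) !(ipZl, ipZr) (ipC (A y) x) -sA; lra.
Qed.

Lemma psd_eq0 A x : psd A -> ip (A x) x = 0 -> A x = 0.
Proof.
move=> pA h; apply: ip_eq0 => y; have := psd_CS x y pA.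
rewrite h mul0r => h'; apply/eqP; rewrite -sqrf_eq0.
by rewrite eq_le h' sqr_ge0.
Qed.

End BoundedOperators.

(** * Riesz representation, projections, adjoints, range inclusion and uniform boundedness *)

Section Riesz.
Variables (R : realType) (H : hilbertType R).
Implicit Types (x y z : H) (A B G T : H -> H) (S W : set H).

Lemma inf_sequence (J : H -> R) S (c : R) : S !=set0 -> (forall x, S x -> c <= J x) ->
  exists (m : R) (u : nat -> H), [/\ forall n, S (u n), forall x, S x -> m <= J x
    & forall n, J (u n) <= m + n.+1%:R^-1].
Proof.
move=> [s Ss] hc.
have hinf : has_inf (J @` S) by split; [exists (J s), s|exists c => _ [x Sx <-]; apply: hc].
have hu n : exists x, S x /\ J x <= inf (J @` S) + n.+1%:R^-1.
  have n0 : (0 : R) < n.+1%:R^-1 by rewrite invr_gt0 ltr0n.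
  by have [_ [x Sx <-] /ltW hx] := inf_adherent n0 hinf; exists x.
have [u hu'] := choice hu.
exists (inf (J @` S)), u; split=> [n|x Sx|n]; [exact: (hu' n).1| |exact: (hu' n).2].
by apply: ge_inf; [exact: hinf.2|exists x].
Qed.

(* Minimizing |L x|^2 - 2 phi x over S.  The choices L = id and L = G yield the Riesz
   representation, the orthogonal projection and Douglas' range criterion. *)
Lemma riesz_range S (L : H -> H) (phi : H -> R) (K : R) :
  S 0 -> (forall (r : R) x y, S x -> S y -> S (x + real_complex R r *: y)) ->
  (forall (r : R) x y, L (x + real_complex R r *: y) = L x + real_complex R r *: L y) ->
  (forall (r : R) x y, phi (x + real_complex R r *: y) = phi x + r * phi y) ->
  (forall x, S x -> phi x <= K * nm (L x)) ->
  exists2 z, closure (L @` S) z & forall x, S x -> phi x = ip (L x) z.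
Proof.
move=> S0 SD LD phiD hphi.
pose J x := nm (L x) ^+ 2 - 2 * phi x.
have JD x d (t : R) : J (x + real_complex R t *: d) =
    nm (L d) ^+ 2 * t ^+ 2 + 2 * (ip (L x) (L d) - phi d) * t + J x.
  by rewrite /J LD phiD nm_sqD ipZr nmZ exprMn real_normK ?num_real //; ring.
(* (|L x| - K)^2 >= 0 bounds J below by -K^2. *)
have J_ge x : S x -> - K ^+ 2 <= J x.
  move=> /hphi; rewrite /J; have := sqr_ge0 (nm (L x) - K); nra.
have [m [u [Su hm hu]]] := inf_sequence (ex_intro _ _ S0) J_ge.
(* J(x + t d) - m is a nonnegative quadratic in t. Its discriminant shows that a near-minimizer
   almost satisfies the Euler equation <L x, L d> = phi d. *)
have variation x d : S x -> S d ->
    (ip (L x) (L d) - phi d) ^+ 2 <= nm (L d) ^+ 2 * (J x - m).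
  move=> Sx Sd; apply: quad_ge0_discr => [|t]; first exact: sqr_ge0.
  by have := hm _ (SD t _ _ Sx Sd); rewrite JD; lra.
(* J is at least m at the midpoint of x and y, so two near-minimizers have close images under L. *)
have parallelogram x y : S x -> S y -> nm (L x - L y) ^+ 2 <= 2 * (J x + J y - 2 * m).
  move=> Sx Sy; have Sd := SD (-1) _ _ Sx Sy.
  have := hm _ (SD 2^-1 _ _ Sy Sd); rewrite JD.
  have := JD y (x + real_complex R (-1) *: y) 1.
  have -> : y + real_complex R 1 *: (x + real_complex R (-1) *: y) = x.
    by rewrite rmorphN scaleN1r scale1r addrC subrK.
  rewrite !LD rmorphN scaleN1r; lra.
have [|z uz] := @cauchy_limit _ _ (L \o u).
  (* Both excesses over m are at most e^2 / 4, and the parallelogram bound doubles their sum. *)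
  move=> e e0; have [|N hN] := @invS_small R (e ^+ 2 / 4); first by rewrite divr_gt0 // exprn_gt0.
  exists N => n k hn hk; rewrite -(ler_pXn2r (n := 2)) ?nnegrE ?nm_ge0 ?(ltW e0) //.
  apply: le_trans (parallelogram _ _ (Su n) (Su k)) _.
  have := lerD (hu n) (hu k); have := lerD (hN n hn) (hN k hk).
  move: (n.+1%:R^-1) (k.+1%:R^-1) => a b; lra.
exists z => [|d Sd].
  by apply: closure_limit uz _ => n; exists (u n).
apply/eqP; rewrite -subr_eq0 -normr_eq0 eq_le normr_ge0 andbT.
apply: (@le_of_eps _ _ _ (2 * nm (L d))); first by rewrite mulr_ge0 ?nm_ge0.
move=> e e0; have [N1 hN1] := uz e e0.
have [|N2 hN2] := @invS_small R (e ^+ 2); first by rewrite exprn_gt0.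
pose n := maxn N1 N2.
have h1 : `|ip (L (u n) - z) (L d)| <= e * nm (L d).
  by rewrite (le_trans (ip_CSabs _ _)) // ler_wpM2r ?nm_ge0 ?hN1 // leq_maxl.
have h2 : `|ip (L (u n)) (L d) - phi d| <= e * nm (L d).
  rewrite -(ler_pXn2r (n := 2)) ?nnegrE ?mulr_ge0 ?nm_ge0 ?(ltW e0) //.
  rewrite real_normK ?num_real // (le_trans (variation _ _ (Su n) Sd)) // mulrC exprMn.
  rewrite ler_wpM2r ?sqr_ge0 //.
  by rewrite lerBlDl (le_trans (hu n)) // lerD2l hN2 // leq_maxr.
have -> : phi d - ip (L d) z
    = ip (L (u n) - z) (L d) - (ip (L (u n)) (L d) - phi d).
  by rewrite ipBl (ipC z); ring.
by rewrite (le_trans (ler_normB _ _)) //; lra.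
Qed.

Lemma closed_subspaceP S : closed_subspace S -> closure S `<=` S.
Proof. by move=> [/closure_id h _ _] x; rewrite -h. Qed.

Lemma subspaceD S x y : closed_subspace S -> S x -> S y -> S (x + y).
Proof. by move=> [_ _ h] Sx Sy; rewrite -[x]scale1r; apply: h. Qed.

Lemma subspaceZ S k x : closed_subspace S -> S x -> S (k *: x).
Proof. by move=> [_ S0 h] Sx; rewrite -[_ *: _]addr0; apply: h. Qed.

Lemma subspaceB S x y : closed_subspace S -> S x -> S y -> S (x - y).
Proof. by move=> hS Sx Sy; rewrite -scaleN1r; apply: subspaceD => //; apply: subspaceZ. Qed.

Lemma orthocompI S x : (forall s, S s -> S ('i%C *: s)) ->
  (forall s, S s -> ip x s = 0) -> orthocomp S x.
Proof.
move=> Si h s Ss; have -> : 0 = '[0 : H, s] by rewrite linear0l.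
apply: innerE; first by rewrite h // ip0l.
rewrite scaler0 ip0l /ip innerZl.
have := h _ (Si _ Ss).
rewrite /ip innerC innerZl innerC; case: '[x, s] => a b /=.
by rewrite !mul0r !mul1r => hb; lra.
Qed.

Lemma orthocompE S x : closed_subspace S ->
  orthocomp S x <-> forall s, S s -> ip x s = 0.
Proof.
move=> hS; split=> [h s Ss|]; first by rewrite /ip h.
by apply: orthocompI => s; apply: subspaceZ.
Qed.

Lemma orthocomp_eq0 S x : S x -> orthocomp S x -> x = 0.
Proof.
by move=> Sx /(_ _ Sx) h; apply/nm_eq0/eqP; rewrite -sqrf_eq0 -ip_nm /ip h.
Qed.

Lemma orthocompB S x y : orthocomp S x -> orthocomp S y -> orthocomp S (x - y).
Proof. by move=> hx hy s Ss; rewrite linearBl /= hx // hy // subrr. Qed.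

Lemma ortho_decomp_unique S x y y' : closed_subspace S ->
  S y -> orthocomp S (x - y) -> S y' -> orthocomp S (x - y') -> y = y'.
Proof.
move=> hS Sy hy Sy' hy'; apply/eqP; rewrite -subr_eq0; apply/eqP.
apply: (@orthocomp_eq0 S); first exact: subspaceB.
have -> : y - y' = (x - y') - (x - y) by rewrite opprB [RHS]addrC addrA subrK.
exact: orthocompB.
Qed.

(** The projection of x is the Riesz vector in S of the functional s -> <s, x>; linearity follows
    from uniqueness of the decomposition. *)
Lemma orthoproj_exists S : closed_subspace S ->
  exists P, bounded_op P /\ forall x, S (P x) /\ orthocomp S (x - P x).
Proof.
move=> hS; have [_ S0 SD] := hS.
have hP x : exists p, S p /\ orthocomp S (x - p).
  have [p] : exists2 p, closure (id @` S) p & forall s, S s -> ip s x = ip s p.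
    apply: (@riesz_range S id (fun s => ip s x) (nm x) S0) => [r a b Sa Sb|//|r a b|s _].
    - by apply: subspaceD => //; apply: subspaceZ.
    - by rewrite ipDl ipZl.
    - by rewrite mulrC ip_CS.
  rewrite image_id => /(closed_subspaceP hS) Sp hp; exists p; split => //.
  by apply/orthocompE => // s Ss; rewrite ipBl !(ipC _ s) hp // subrr.
have [P {}hP] := choice hP; exists P; split => //.
apply: (@bounded_opI _ _ _ 1) => [k x y|x].
  apply: (@ortho_decomp_unique S (k *: x + y)) => //; try exact: (hP _).1.
  - exact: (hP _).2.
  - exact: SD (hP x).1 (hP y).1.
  move=> s Ss; have -> : k *: x + y - (k *: P x + P y) = k *: (x - P x) + (y - P y).
    by rewrite scalerBr opprD addrACA.
  by rewrite linearDl /= innerZl (hP x).2 // (hP y).2 // mulr0 addr0.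
rewrite mul1r; have /(orthocompE _ hS) /(_ _ (hP x).1) := (hP x).2.
rewrite ipBl ip_nm => h; have := ip_CS x (P x).
have := nm_ge0 x; have := nm_ge0 (P x); nra.
Qed.

Lemma orthoprojP S : closed_subspace S -> bounded_op (orthoproj S) /\
  forall x, S (orthoproj S x) /\ orthocomp S (x - orthoproj S x).
Proof.
move=> /orthoproj_exists[P hP]; rewrite /orthoproj /the_op.
by case: xgetP => [Q _ //|/(_ P)].
Qed.

Lemma orthoproj_id S x : closed_subspace S -> S x -> orthoproj S x = x.
Proof.
move=> hS Sx; have [_ /(_ x)[h1 h2]] := orthoprojP hS.
apply: (ortho_decomp_unique hS h1 h2 Sx) => s _.
by rewrite subrr linear0l.
Qed.

Lemma orthoproj_selfadjoint S : closed_subspace S ->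
  real_adjoint (orthoproj S) (orthoproj S).
Proof.
move=> hS x y; have [_ h] := orthoprojP hS.
have /(orthocompE _ hS) /(_ _ (h y).1) := (h x).2.
have /(orthocompE _ hS) /(_ _ (h x).1) := (h y).2.
by rewrite !ipBl !(ipC _ (orthoproj S x)) (ipC x); lra.
Qed.

Lemma orthoproj_eq0 S x : closed_subspace S -> orthocomp S x -> orthoproj S x = 0.
Proof.
move=> hS hx; apply: ip_eq0 => y; rewrite orthoproj_selfadjoint //.
by apply: (orthocompE x hS).1 hx _ ((orthoprojP hS).2 y).1.
Qed.

Lemma adjoint_exists A : bounded_op A -> exists A', real_adjoint A A'.
Proof.
move=> bA; have [M M0 hM] := bounded_opP bA.
have ex y : exists z, forall x, ip (A x) y = ip x z.
  have [z _ hz] : exists2 z, closure (id @` setT) z &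
      forall x, setT x -> ip (A x) y = ip x z.
    apply: (@riesz_range setT id (fun x => ip (A x) y) (M * nm y)) => // [r a b|x _].
    - by rewrite (bopD _ _ bA) (bopZ _ _ bA) ipDl ipZl.
    - by rewrite (le_trans (ip_CS _ _)) // mulrAC ler_wpM2r ?nm_ge0.
  by exists z => x; apply: hz.
by have [A' hA'] := choice ex; exists A'.
Qed.

Lemma adjoint_spec A : bounded_op A -> real_adjoint A (adjoint A).
Proof. by move=> bA; have [A' h] := adjoint_exists bA; rewrite (adjointP bA h). Qed.

(** The bound makes G y -> <y, v> a well-defined bounded functional on R(G); its Riesz vector z
    satisfies <G y, z> = <y, v> for all y, that is, G z = v. Taking z in the closure of R(G) makes
    it orthogonal to N(G). *)
Lemma douglas_range G v (K : R) : bounded_op G -> real_adjoint G G ->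
  (forall y, ip y v <= K * nm (G y)) -> exists2 z, closure (range G) z & G z = v.
Proof.
move=> bG sG hv.
have [z cz hz] : exists2 z, closure (range G) z & forall y, setT y -> ip y v = ip (G y) z.
  apply: (@riesz_range setT G (fun y => ip y v) K) => // r a b.
  - by rewrite (bopD _ _ bG) (bopZ _ _ bG).
  - by rewrite ipDl ipZl.
by exists z => //; apply: ip_inj => y; rewrite sG ipC -(hz _ I) ipC.
Qed.

Lemma closure_range_ortho G z w : real_adjoint G G ->
  closure (range G) z -> G w = 0 -> ip z w = 0.
Proof.
move=> sG /closureP hz Gw; apply/eqP; rewrite -normr_eq0 eq_le normr_ge0 andbT.
apply: (@le_of_eps _ _ _ (nm w)); first exact: nm_ge0.
move=> e e0; have [_ [y _ <-] hy] := hz e e0.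
have -> : ip z w = ip (z - G y) w by rewrite ipBl sG Gw ip0r subr0.
by rewrite add0r (le_trans (ip_CSabs _ _)) // mulrC ler_wpM2l ?nm_ge0 // ltW.
Qed.

Lemma uniform_boundedness (V : set H) :
  (forall x, exists M : R, forall v, V v -> `|ip x v| <= M) ->
  exists M : R, forall v, V v -> nm v <= M.
Proof.
move=> hV; apply: contrapT => unb.
have unbounded (M : R) : exists v, V v /\ M < nm v.
  apply: contrapT => h; apply: unb; exists M => v Vv.
  by rewrite leNgt; apply/negP => hv; apply: h; exists v.
(* Sokal's gliding hump: of x + d and x - d with |d| = 3^-n, one pairs with v to at
   least 3^-n |v| in absolute value. *)
have step (nx : nat * H) : exists y v, [/\ V v, nm (y - nx.2) <= 3^-1 ^+ nx.1
    & 2 * nx.1%:R <= 3^-1 ^+ nx.1 * nm v /\ 3^-1 ^+ nx.1 * nm v <= `|ip y v|].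
  case: nx => n x /=; set r : R := 3^-1 ^+ n.
  have r0 : 0 < r by rewrite exprn_gt0 // invr_gt0.
  have [v [Vv hv]] := unbounded (2 * n%:R / r).
  have v0 : 0 < nm v by apply: le_lt_trans hv; rewrite divr_ge0 ?mulr_ge0 // ltW.
  (* The multiple of v of length r. The sign of <x, v> decides whether adding or subtracting it
     makes the pairing with v large. *)
  pose d := real_complex R (r / nm v) *: v.
  have nd : nm d = r by rewrite nmZ gtr0_norm ?divr_gt0 // divfK // gt_eqF.
  have dv : ip d v = r * nm v by rewrite ipZl ip_nm; field; rewrite gt_eqF.
  have rv : 2 * n%:R <= r * nm v by rewrite [r * _]mulrC -ler_pdivrMr // ltW.
  have [h|h] := lerP 0 (ip x v).
    exists (x + d), v; split; rewrite ?(addrC x) ?addrK ?nd //; split => //.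
    by rewrite ipDl dv ger0_norm ?lerDl // addr_ge0 // mulr_ge0 ?ltW.
  exists (x - d), v; split; rewrite ?(addrC x) ?addrK ?nmN ?nd //; split => //.
  rewrite ipDl ipNl dv ler0_norm; last first.
    by have : 0 < r * nm v; [rewrite mulr_gt0|lra].
  by lra.
have [F hF0] := choice step.
have [E hF] := choice hF0.
pose x := fix x n := if n is k.+1 then F (k, x k) else 0.
have hx n := hF (n, x n); have {hx} hx n : [/\ V (E (n, x n)),
    nm (x n.+1 - x n) <= 3^-1 ^+ n
  & 2 * n%:R <= 3^-1 ^+ n * nm (E (n, x n)) /\
    3^-1 ^+ n * nm (E (n, x n)) <= `|ip (x n.+1) (E (n, x n))| ].
  exact: hx n.
have p3 n : (0 : R) < 3^-1 ^+ n by rewrite exprn_gt0 // invr_gt0.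
(* The right side is the geometric sum of 3^-j for n <= j < n + k. *)
have tail n k : nm (x (n + k)%N - x n) <= 3 / 2 * 3^-1 ^+ n - 3 / 2 * 3^-1 ^+ (n + k).
  elim: k => [|k ih]; first by rewrite addn0 !subrr nm0.
  rewrite addnS; apply: le_trans (nm_triangle (x (n + k)%N) _ _) _.
  have [_ h _] := hx (n + k)%N.
  by rewrite [_ ^+ (n + k).+1]exprS; lra.
have tail' N n : (N <= n)%N -> nm (x n - x N) <= 3 / 2 * 3^-1 ^+ N.
  by move=> /subnKC <-; rewrite (le_trans (tail _ _)) //; have := p3 (N + (n - N))%N; lra.
have [|l xl] := @cauchy_limit _ _ x.
  move=> e e0.
  have [|N hN] := @invS_small R (e / 3); first by rewrite divr_gt0.
  have h3 : (3 : R)^-1 ^+ N <= e / 3.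
    apply: le_trans (hN N (leqnn _)); rewrite exprVn.
    rewrite lef_pV2 ?posrE ?exprn_gt0 ?ltr0n // -natrX ler_nat.
    exact: ltn_expl.
  exists N => n k hn hk; apply: le_trans (nm_triangle (x N) _ _) _.
  rewrite (nmBC (x N)).
  have := tail' _ _ hn; have := tail' _ _ hk; lra.
have [M hM] := hV l.
pose n := (Num.truncn M).+1.
have [Vv _ [h1 h2]] := hx n.
(* The steps after step n total at most 3/2 * 3^-(n+1), half of the hump. Hence |<l, v>| keeps at
   least half of 3^-n |v|, so at least n, which exceeds M. *)
have hl : nm (l - x n.+1) <= 2^-1 * 3^-1 ^+ n.
  apply: (@limit_le_nm _ _ x l _ _ n.+1 xl) => k hk.
  by rewrite (le_trans (tail' _ _ hk)) // exprS; lra.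
have h3 := le_trans (ip_CSabs _ _) (ler_wpM2r (nm_ge0 (E (n, x n))) hl).
have h4 : `|ip (x n.+1) (E (n, x n))|
    <= `|ip (l - x n.+1) (E (n, x n))| + `|ip l (E (n, x n))|.
  rewrite -normrN; apply: le_trans (ler_normB _ _).
  by rewrite ipBl; have -> : forall a b : R, a - b - a = - b by move=> a b; ring.
have h5 := hM _ Vv.
have h6 : M < n%:R by exact: truncnS_gt.
by rewrite -mulrA in h3; lra.
Qed.

(* Hellinger-Toeplitz, for a formal adjoint defined on a dense part of the range. *)
Lemma bounded_of_formal_adjoint T W : linear T ->
  (forall (r : R) w, W w -> W (real_complex R r *: w)) ->
  (forall x, closure W (T x)) ->
  (forall w, W w -> exists w', forall x, ip (T x) w = ip x w') -> bounded_op T.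
Proof.
move=> lT WZ TW Wadj.
(* V is the image of the unit ball of W under the formal adjoint. It is pointwise bounded, since
   |<x, v>| = |<T x, w>| <= |T x|. *)
pose V := [set v | exists w, [/\ W w, nm w <= 1 & forall x, ip (T x) w = ip x v]].
have [x|M0 hM0] := @uniform_boundedness V.
  exists (nm (T x)) => v [w [_ w1 h]]; rewrite -h (le_trans (ip_CSabs _ _)) //.
  by rewrite ler_piMr ?nm_ge0.
pose M := Num.max M0 0; have M_ge0 : 0 <= M by rewrite le_max lexx orbT.
have hM v : V v -> nm v <= M by move=> /hM0 h; rewrite le_max h.
have key x w : W w -> ip (T x) w <= M * nm x * nm w.
  move=> Ww; have [w0|w0] := eqVneq (nm w) 0.
    by rewrite (nm_eq0 w0) ip0r nm0 mulr0.
  have p : 0 < nm w by rewrite lt_def w0 nm_ge0.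
  have [v hv] := Wadj _ (WZ (nm w)^-1 _ Ww).
  have /hM hv1 : V v.
    exists (real_complex R (nm w)^-1 *: w); split => //; first exact: WZ.
    by rewrite nmZ gtr0_norm ?invr_gt0 // mulVf.
  have := le_trans (ip_CS x v) (ler_wpM2l (nm_ge0 x) hv1).
  by rewrite -hv ipZr mulrC ler_pdivrMr // (mulrC (nm x)).
apply: (@bounded_opI _ _ _ M) => // x.
have h : nm (T x) ^+ 2 <= M * nm x * nm (T x).
  (* The bound for w in W passes to w = T x by approximation, because T x lies in the closure of
     W. *)
  apply: (@le_of_eps _ _ _ (nm (T x) + M * nm x)).
    by rewrite addr_ge0 ?mulr_ge0 ?nm_ge0.
  move=> e e0; have /closureP /(_ e e0)[w Ww hw] := TW x.
  have -> : nm (T x) ^+ 2 = ip (T x) (T x - w) + ip (T x) w.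
    by rewrite -ip_nm -ipDr subrK.
  have h1 := ip_CS (T x) (T x - w); have h2 := key x _ Ww.
  have h3 : nm w <= nm (T x) + e.
    by have := nmD (w - T x) (T x); rewrite subrK nmBC; lra.
  have h4 : M * nm x * nm w <= M * nm x * (nm (T x) + e).
    by rewrite ler_wpM2l ?mulr_ge0 ?nm_ge0.
  have h5 : nm (T x) * nm (T x - w) <= nm (T x) * e by rewrite ler_wpM2l ?nm_ge0 // ltW.
  by lra.
have [->|n0] := eqVneq (nm (T x)) 0; first by rewrite mulr_ge0 ?nm_ge0.
have p : 0 < nm (T x) by rewrite lt_def n0 nm_ge0.
by rewrite -(ler_pM2r p) -expr2.
Qed.

End Riesz.

(** * Square roots of positive operators, with their commutation property *)

Section SquareRoot.
Variables (R : realType) (H : hilbertType R).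
Implicit Types (x y z : H) (A B K Q X Y : H -> H).

Lemma adjoint_linear A B : is_adjoint A B -> linear A.
Proof.
move=> h k x y; apply: ip_inj => z; congr complex.Re.
by rewrite linearDl /= innerZl !h linearDl /= innerZl.
Qed.

Lemma nmZi x : nm ('i%C *: x) = nm x.
Proof.
rewrite /nm normrZ normc_def /= expr0n expr1n add0r sqrtr1.
by case: `|x| => a b /=; rewrite mul0r mul1r subr0.
Qed.

Lemma limit_bop A (u : nat -> H) l : bounded_op A -> limit_of u l ->
  limit_of (A \o u) (A l).
Proof.
move=> bA h e e0; have [M M0 hM] := bounded_opP bA.
have M1 : 0 < M + 1 by lra.
have [|N hN] := h (e / (M + 1)); first by rewrite divr_gt0.
exists N => n hn; rewrite -(bopB _ _ bA) (le_trans (hM _)) //.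
rewrite (@le_trans _ _ ((M + 1) * nm (u n - l))) ?ler_wpM2r ?nm_ge0 //; first lra.
by rewrite mulrC -ler_pdivlMr // hN.
Qed.

Lemma limit_ip (u v : nat -> H) l m x y : limit_of u l -> limit_of v m ->
  (forall n, ip (u n) y = ip x (v n)) -> ip l y = ip x m.
Proof.
move=> hu hv huv; apply/eqP; rewrite -subr_eq0 -normr_eq0 eq_le normr_ge0 andbT.
apply: (@le_of_eps _ _ _ (nm x + nm y)) => [|e e0]; first by rewrite addr_ge0 ?nm_ge0.
have [N1 h1] := hu e e0; have [N2 h2] := hv e e0; pose n := maxn N1 N2.
have {}h1 := h1 n (leq_maxl _ _); have {}h2 := h2 n (leq_maxr _ _).
have -> : ip l y - ip x m = ip x (v n - m) - ip (u n - l) y.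
  by rewrite ipBl ipBr huv; ring.
rewrite add0r (le_trans (ler_normB _ _)) // mulrDl lerD //.
  by rewrite (le_trans (ip_CSabs _ _)) // ler_wpM2l ?nm_ge0.
by rewrite (le_trans (ip_CSabs _ _)) // mulrC ler_wpM2l ?nm_ge0.
Qed.

Fixpoint sqrt_iter X n : H -> H :=
  if n is k.+1 then
    fun x => real_complex R 2^-1 *: (X x + sqrt_iter X k (sqrt_iter X k x))
  else fun=> 0.

(** The recursion of [sqrt_iter] for the scalar X = 1, used as a majorant: it bounds the norms of
    the iterates and its increments bound theirs. Being increasing and at most 1, it makes the
    iterates Cauchy. *)
Fixpoint sqrt_bound n : R := if n is k.+1 then 2^-1 * (1 + sqrt_bound k ^+ 2) else 0.

Lemma sqrt_bound_itv n : 0 <= sqrt_bound n <= 1.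
Proof. by elim: n => [|n /andP[h0 h1]] /=; [lra|apply/andP; split; nra]. Qed.

Lemma sqrt_bound_mono n : sqrt_bound n <= sqrt_bound n.+1.
Proof. by rewrite /=; have := sqr_ge0 (1 - sqrt_bound n); lra. Qed.

Lemma sqrt_bound_cauchy (e : R) : 0 < e ->
  exists N, forall k, sqrt_bound (N + k) - sqrt_bound N <= e.
Proof.
move=> e0; pose E := range sqrt_bound.
have hE : has_sup E.
  split; first by exists (sqrt_bound 0), 0%N.
  by exists 1 => _ [n _ <-]; case/andP: (sqrt_bound_itv n).
have [_ [N _ <-] hN] := sup_adherent e0 hE.
exists N => k.
have : sqrt_bound (N + k) <= sup E by apply: ub_le_sup; [exact: hE.2|exists (N + k)%N].
by lra.
Qed.

Section Iteration.
Variable X : H -> H.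
Hypotheses (bX : bounded_op X) (sX : real_adjoint X X)
  (X1 : forall x, nm (X x) <= nm x).
Local Notation Y := (sqrt_iter X).

Lemma sqrt_iter_bounded n : bounded_op (Y n).
Proof.
elim: n => [|n ih]; first exact: bounded_zero.
exact: (bounded_scale 2^-1 (bounded_add bX (bounded_comp ih ih))).
Qed.

Lemma sqrt_iter_adjoint n : real_adjoint (Y n) (Y n).
Proof.
elim: n => [|n ih] x y /=; first by rewrite ip0l ip0r.
by rewrite ipZl ipZr ipDl ipDr sX !ih.
Qed.

Lemma nm_half x : nm (real_complex R 2^-1 *: x) = 2^-1 * nm x.
Proof. by rewrite nmZ gtr0_norm // invr_gt0. Qed.

Lemma sqrt_iter_le n x : nm (Y n x) <= sqrt_bound n * nm x.
Proof.
elim: n x => [|n ih] x /=; first by rewrite nm0 mul0r.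
rewrite nm_half -mulrA ler_pM2l ?invr_gt0 // (le_trans (nmD _ _)) // mulrDl mul1r.
rewrite lerD // (le_trans (ih _)) // expr2 -mulrA ler_wpM2l //.
by case/andP: (sqrt_bound_itv n).
Qed.

Lemma sqrt_iter_le1 n x : nm (Y n x) <= nm x.
Proof.
apply: le_trans (sqrt_iter_le _ _) _; rewrite ler_piMl ?nm_ge0 //.
by case/andP: (sqrt_bound_itv n).
Qed.

Lemma sqrt_iter_step n x :
  nm (Y n.+1 x - Y n x) <= (sqrt_bound n.+1 - sqrt_bound n) * nm x.
Proof.
elim: n x => [|n ih] x.
  by have := sqrt_iter_le 1 x; rewrite [Y 0 x]/= [sqrt_bound 0]/= !subr0.
(* Y'^2 - Y^2 = (Y' - Y) Y' + Y (Y' - Y); the increments of [sqrt_bound] factor in the same way. *)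
have -> : Y n.+2 x - Y n.+1 x = real_complex R 2^-1 *:
    ((Y n.+1 (Y n.+1 x) - Y n (Y n.+1 x)) + Y n (Y n.+1 x - Y n x)).
  rewrite (bopB _ _ (sqrt_iter_bounded n)) addrA subrK.
  rewrite [Y n.+2 x]/= [X in _ - X = _]/= -scalerBr opprD addrACA subrr add0r.
  by [].
rewrite nm_half.
have h1 := ih (Y n.+1 x); have h2 := sqrt_iter_le n.+1 x.
have h3 := sqrt_iter_le n (Y n.+1 x - Y n x); have h4 := ih x.
have h5 := sqrt_bound_mono n.
have /andP[h6 h7] := sqrt_bound_itv n.
have h8 := ler_wpM2l h6 h4.
have h9 : 0 <= sqrt_bound n.+1 - sqrt_bound n by lra.
have h10 := ler_wpM2l h9 h2.
have h11 := nmD (Y n.+1 (Y n.+1 x) - Y n (Y n.+1 x)) (Y n (Y n.+1 x - Y n x)).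
have -> : sqrt_bound n.+2 - sqrt_bound n.+1
  = 2^-1 * ((sqrt_bound n.+1 - sqrt_bound n) * (sqrt_bound n.+1 + sqrt_bound n)).
  by rewrite /=; field.
rewrite -mulrA ler_pM2l ?invr_gt0 //; lra.
Qed.

Lemma sqrt_iter_tail n k x :
  nm (Y (n + k)%N x - Y n x) <= (sqrt_bound (n + k) - sqrt_bound n) * nm x.
Proof.
elim: k => [|k ih]; first by rewrite addn0 !subrr nm0 mul0r.
rewrite addnS; apply: le_trans (nm_triangle (Y (n + k)%N x) _ _) _.
by have := sqrt_iter_step (n + k) x; lra.
Qed.

Lemma sqrt_iter_limit x : exists l, limit_of (fun n => Y n x) l.
Proof.
apply: cauchy_limit => e e0.
have c : 0 < 2 * (nm x + 1) by have := nm_ge0 x; lra.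
have [|N hN] := @sqrt_bound_cauchy (e / (2 * (nm x + 1))); first by rewrite divr_gt0.
have hN' n : (N <= n)%N -> nm (Y n x - Y N x) <= e / 2.
  move=> /subnKC <-; apply: le_trans (sqrt_iter_tail _ _ _) _.
  have := hN (n - N)%N; rewrite ler_pdivlMr //.
  have := sqrt_bound_mono; move: (sqrt_bound _ - _) => t _ ht.
  have [t0|t0] := lerP 0 t; first by have := nm_ge0 x; nra.
  by have := nm_ge0 x; nra.
exists N => n m hn hm; apply: le_trans (nm_triangle (Y N x) _ _) _.
by rewrite (nmBC (Y N x)); have := hN' _ hn; have := hN' _ hm; lra.
Qed.

Lemma sqrt_iter_comm K : bounded_op K -> (forall x, K (X x) = X (K x)) ->
  forall n x, K (Y n x) = Y n (K x).
Proof.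
move=> bK KX; elim=> [|n ih] x /=; first exact: bop0.
by rewrite (bopZ _ _ bK) (bopD _ _ bK) KX !ih.
Qed.

(* The solution Y of Y = (X + Y^2) / 2, that is, of (1 - Y)^2 = 1 - X. *)
Lemma sqrt_fixpoint : exists Y, [/\ bounded_op Y, real_adjoint Y Y,
    forall x, nm (Y x) <= nm x,
    forall x, Y x = real_complex R 2^-1 *: (X x + Y (Y x))
  & forall K, bounded_op K -> (forall x, K (X x) = X (K x)) ->
      forall x, K (Y x) = Y (K x)].
Proof.
have [L hL] := choice sqrt_iter_limit.
have aL : real_adjoint L L.
  by move=> x y; apply: limit_ip (hL x) (hL y) _ => n; apply: sqrt_iter_adjoint.
have L1 x : nm (L x) <= nm x.
  rewrite -[L x]subr0; apply: (limit_le_nm (N := 0) (hL x)) => n _.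
  by rewrite subr0 sqrt_iter_le1.
(* A map with a complex adjoint is linear. The imaginary part of the adjoint relation is the limit
   of the relations for i [Y n]. *)
have linL : linear L.
  apply: (@adjoint_linear _ L) => x y; apply: innerE; first exact: aL.
  apply: (@limit_ip (fun n => 'i%C *: Y n x)) (hL y) _ => [e e0|n].
    have [N hN] := hL x e e0; exists N => n /hN.
    by rewrite -scalerBr nmZi.
  by rewrite -(bopZ _ _ (sqrt_iter_bounded n)) sqrt_iter_adjoint.
exists L; split => //.
- by apply: (@bounded_opI _ _ _ 1) => // x; rewrite mul1r.
- move=> x; apply: (@limit_unique _ _ (fun n => Y n.+1 x)) => e e0.
    by have [N hN] := hL x e e0; exists N => n hn; apply/hN/leqW.
  have [N1 h1] := hL x e e0; have [N2 h2] := hL (L x) e e0.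
  exists (maxn N1 N2) => n; rewrite geq_max => /andP[/h1 {}h1 /h2 {}h2] /=.
  rewrite -scalerBr nm_half opprD addrACA subrr add0r.
  have := nm_triangle (Y n (L x)) (Y n (Y n x)) (L (L x)).
  rewrite -(bopB _ _ (sqrt_iter_bounded n)).
  by have := sqrt_iter_le1 n (Y n x - L x); lra.
- move=> K bK KX x; apply: (limit_unique (limit_bop bK (hL x))).
  have -> : K \o (fun n => Y n x) = (fun n => Y n (K x)).
    by apply/funext => n /=; rewrite (sqrt_iter_comm bK KX).
  exact: hL.
Qed.

End Iteration.

(** Cauchy-Schwarz for the form of [A] at x and A x gives |A x|^4 <= <A x, x> <A A x, A x>, and the
    last factor is at most M |A x|^2. This is the inequality A^2 <= M A. *)
Lemma psd_nm_sq A (M : R) x : psd A -> (forall y, nm (A y) <= M * nm y) ->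
  nm (A x) ^+ 2 <= M * ip (A x) x.
Proof.
move=> pA hM; have h := psd_CS x (A x) pA.
have /psdE[_ pos] := pA; have := pos x.
have [h0|h0] := eqVneq (nm (A x)) 0.
  by rewrite (nm_eq0 h0) nm0 expr0n ip0l mulr0.
have p : 0 < nm (A x) ^+ 2 by rewrite exprn_gt0 // lt_def h0 nm_ge0.
move=> px; rewrite -(ler_pM2r p).
have h1 : ip (A (A x)) (A x) <= M * nm (A x) ^+ 2.
  by rewrite (le_trans (ip_CS _ _)) // expr2 mulrA ler_wpM2r ?nm_ge0.
have := ler_wpM2l px h1; rewrite ip_nm in h; nra.
Qed.

(** For M > 0 bounding the norm of [A], X = 1 - A / M is a contraction by A^2 <= M A. The fixed
    point Y satisfies (1 - Y)^2 = 1 - X = A / M, so Q = M^(1/2) (1 - Y). The commutation clause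
    serves uniqueness, and later puts [G] in commutation with the projections. *)
Lemma psd_sqrt_exists A : psd A -> exists Q, [/\ psd Q, Q \o Q = A
  & forall K, bounded_op K -> (forall x, K (A x) = A (K x)) ->
      forall x, K (Q x) = Q (K x)].
Proof.
move=> pA; have /psdE[/selfadjointE[bA sA] posA] := pA.
have [M0 M0_ge0 hM0] := bounded_opP bA.
pose M := M0 + 1; have M_gt0 : 0 < M by rewrite /M; lra.
have M_neq0 : M != 0 by rewrite gt_eqF.
have hM y : nm (A y) <= M * nm y.
  by rewrite (le_trans (hM0 _)) // ler_wpM2r ?nm_ge0 // /M; lra.
pose X x := x + real_complex R (- M^-1) *: A x.
have bX : bounded_op X := bounded_lincomb (- M^-1) (bounded_id H) bA.
have sX : real_adjoint X X by move=> x y; rewrite /X ipDl ipDr ipZl ipZr sA.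
have X1 x : nm (X x) <= nm x.
  rewrite -(ler_pXn2r (n := 2)) ?nnegrE ?nm_ge0 //.
  rewrite /X nm_sqD ipZr nmZ exprMn real_normK ?num_real // sqrrN.
  have := psd_nm_sq x pA hM; have := posA x; rewrite (ipC x).
  move: (nm (A x) ^+ 2) (ip (A x) x) => u v v0 uv.
  have i0 : 0 < M^-1 by rewrite invr_gt0.
  have h1 : M^-1 ^+ 2 * u <= M^-1 * v.
    by rewrite expr2 -mulrA ler_pM2l // mulrC ler_pdivrMr // mulrC.
  have h2 : 0 <= M^-1 * v by rewrite mulr_ge0 // ltW.
  by lra.
have [Y [bY sY Y1 Yfix Ycomm]] := sqrt_fixpoint bX sX X1.
pose Q x := real_complex R (Num.sqrt M) *: (x - Y x).
have bQ : bounded_op Q := bounded_scale (Num.sqrt M) (bounded_sub (bounded_id H) bY).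
have sq2 : Num.sqrt M * Num.sqrt M = M by rewrite -expr2 sqr_sqrtr // ltW.
exists Q; split.
- apply/psdE; split=> [|x].
    by apply/selfadjointE; split => // x y; rewrite /Q ipZl ipZr ipBl ipBr sY.
  rewrite /Q ipZl mulr_ge0 ?sqrtr_ge0 // ipBl subr_ge0 ip_nm.
  by rewrite (le_trans (ip_CS _ _)) // expr2 ler_wpM2r ?nm_ge0.
- apply/funext => x /=; rewrite {1}/Q.
  rewrite (_ : Q x - Y (Q x) = real_complex R (Num.sqrt M) *: (X x - X x + (x - X x))).
    rewrite subrr add0r scalerA -rmorphM sq2 /X opprD addrA subrr sub0r.
    by rewrite rmorphN scaleNr opprK scalerA -rmorphM mulfV // scale1r.
  rewrite subrr add0r /Q (bopZ _ _ bY) -scalerBr (bopB _ _ bY); congr (_ *: _).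
  have h : Y x + Y x = X x + Y (Y x).
    rewrite {1 2}Yfix -scalerDl -rmorphD.
    by have -> : 2^-1 + 2^-1 = 1 :> R; [field|rewrite scale1r].
  have -> : x - Y x - (Y x - Y (Y x)) = x - (Y x + Y x) + Y (Y x).
    by rewrite opprB opprD !addrA addrAC.
  by rewrite h opprD addrA subrK.
- move=> K bK KA x; rewrite /Q (bopZ _ _ bK) (bopB _ _ bK) (Ycomm _ bK) // => y.
  by rewrite /X (bopD _ _ bK) (bopZ _ _ bK) KA.
Qed.

(** With y = Q x - Q' x, commutation gives (Q + Q') y = (Q^2 - Q'^2) x = 0. Both forms being
    nonnegative, Q y = Q' y = 0, and then |y|^2 = <Q y - Q' y, x> = 0. *)
Lemma psd_sqrt_unique Q Q' : psd Q -> psd Q' -> Q \o Q = Q' \o Q' ->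
  (forall x, Q (Q' x) = Q' (Q x)) -> Q = Q'.
Proof.
move=> pQ pQ' hQQ comm.
have /psdE[/selfadjointE[bQ sQ] posQ] := pQ.
have /psdE[/selfadjointE[bQ' sQ'] posQ'] := pQ'.
apply/funext => x; pose y := Q x - Q' x.
have sum0 : Q y + Q' y = 0.
  rewrite /y (bopB _ _ bQ) (bopB _ _ bQ') comm addrA subrK.
  by have /(congr1 (@^~ x)) /= -> := hQQ; rewrite subrr.
have h : ip (Q y) y + ip (Q' y) y = 0 by rewrite -ipDl sum0 ip0l.
have Qy : Q y = 0 by apply: psd_eq0 => //; have := posQ y; have := posQ' y; lra.
have Qy' : Q' y = 0 by rewrite Qy add0r in sum0.
apply/eqP; rewrite -subr_eq0 -/y; apply/eqP/nm_eq0/eqP.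
by rewrite -sqrf_eq0 -ip_nm {2}/y ipBr -sQ -sQ' Qy Qy' subrr.
Qed.

Lemma op_sqrtP A : psd A -> [/\ psd (op_sqrt A), op_sqrt A \o op_sqrt A = A
  & forall K, bounded_op K -> (forall x, K (A x) = A (K x)) ->
      forall x, K (op_sqrt A x) = op_sqrt A (K x)].
Proof.
move=> pA; have [Q [pQ QQ Qcomm]] := psd_sqrt_exists pA.
suff -> : op_sqrt A = Q by [].
rewrite /op_sqrt /the_op; case: xgetP => [Q' _ [pQ' QQ']|/(_ Q)]; last by case.
apply/esym/psd_sqrt_unique => //; first by rewrite QQ.
(* Any root Q' commutes with A = Q'^2, hence with the root Q just constructed. *)
move=> x; rewrite (Qcomm Q') //; first exact: pQ'.1.
by move=> y; rewrite -QQ'.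
Qed.

Lemma op_sqrt_unique Q : psd Q -> op_sqrt (Q \o Q) = Q.
Proof.
move=> pQ; have /psdE[/selfadjointE[bQ sQ] _] := pQ.
have pQQ : psd (Q \o Q).
  apply/psdE; split=> [|x] /=; last by rewrite sQ ip_nm sqr_ge0.
  by apply/selfadjointE; split; [exact: bounded_comp|move=> x y /=; rewrite !sQ].
have [p1 h1 c1] := op_sqrtP pQQ.
by apply: psd_sqrt_unique => // x; rewrite (c1 Q).
Qed.

End SquareRoot.

(** * Reduced solutions, and extremal operators recognized by their quadratic forms *)

Section OperatorConstructions.
Variables (R : realType) (H : hilbertType R).
Implicit Types (x y z : H) (A B C F G K L X Y : H -> H) (S T : set H).

Lemma nullspace_closed A : bounded_op A -> closed_subspace (nullspace A).
Proof.
move=> bA; have [M M0 hM] := bounded_opP bA; split.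
- apply/closure_id/seteqP; split; first exact: subset_closure.
  move=> x /closureP hx; apply/nm_eq0/eqP; rewrite eq_le nm_ge0 andbT.
  apply: (le_of_eps M0) => e e0; have [y Ay hy] := hx e e0.
  have -> : A x = A (x - y) by rewrite (bopB _ _ bA) Ay subr0.
  by rewrite add0r (le_trans (hM _)) // ler_wpM2l // ltW.
- exact: bop0.
- by move=> k x y /= Ax Ay; rewrite /nullspace /= (bopD _ _ bA) (bopZ _ _ bA) Ax Ay scaler0 addr0.
Qed.

Lemma closure_range_orthocomp G z : bounded_op G -> real_adjoint G G ->
  closure (range G) z -> orthocomp (nullspace G) z.
Proof.
move=> bG sG cz; apply: orthocompI => s; rewrite /nullspace /= => Gs.
  by rewrite (bopZ _ _ bG) Gs scaler0.
exact: closure_range_ortho cz Gs.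
Qed.

(** F x is the preimage of B x in the closure of R(G); orthogonality to N(G) makes it unique, hence
    linear in x. Boundedness comes from the formal adjoint on R(G): <F x, G y> = <B x, y> = <x, B'
    y>. *)
Lemma reduced_solutionP G B : bounded_op G -> real_adjoint G G -> bounded_op B ->
  range B `<=` range G ->
  [/\ bounded_op (reduced_solution G B), B = G \o reduced_solution G B,
      nullspace (reduced_solution G B) = nullspace B
    & range (reduced_solution G B) `<=` closure (range G)].
Proof.
move=> bG sG bB hBG.
rewrite /reduced_solution /the_op; case: xgetP => [F _ //|h].
have ex x : exists z, closure (range G) z /\ G z = B x.
  have [y _ Gy] : range G (B x) by apply: hBG; exists x.
  have [|z cz Gz] := @douglas_range _ _ G (B x) (nm y) bG sG; last by exists z.
  by move=> u; rewrite -Gy -sG mulrC ip_CS.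
have [F hF] := choice ex.
have Fo x : orthocomp (nullspace G) (F x) := closure_range_orthocomp bG sG (hF x).1.
have GF x : G (F x) = B x := (hF x).2.
have linF : linear F.
  move=> k x y; apply/eqP; rewrite -subr_eq0; apply/eqP.
  apply: (@orthocomp_eq0 _ _ (nullspace G)).
    rewrite /nullspace /= (bopB _ _ bG) (bopD _ _ bG) (bopZ _ _ bG) !GF.
    by rewrite (bopD _ _ bB) (bopZ _ _ bB) subrr.
  move=> s Gs; rewrite linearBl /= linearDl /= innerZl !Fo //.
  by rewrite mulr0 addr0 subrr.
have [B' hB'] := adjoint_exists bB.
have bF : bounded_op F.
  apply: (@bounded_of_formal_adjoint _ _ F (range G)) => //.
  - by move=> r _ [y _ <-]; exists (real_complex R r *: y) => //; rewrite (bopZ _ _ bG).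
  - by move=> x; apply: (hF x).1.
  - by move=> _ [y _ <-]; exists (B' y) => x; rewrite -sG GF hB'.
case: (h F); split => //.
- by apply/funext => x /=; rewrite GF.
- apply/seteqP; split => x; rewrite /nullspace /= => hx.
    by rewrite -GF hx (bop0 bG).
  apply: (@orthocomp_eq0 _ _ (nullspace G)) => //.
  by rewrite /nullspace /= GF.
- by move=> _ [x _ <-]; apply: (hF x).1.
Qed.

Lemma range_orthocomp X T : selfadjoint X ->
  range X `<=` orthocomp T <-> forall t, T t -> X t = 0.
Proof.
move=> [bX sX]; split=> [h t Tt|h _ [x _ <-] t Tt]; last by rewrite sX h // linear0r.
by apply: ip_eq0 => y; rewrite /ip sX innerC h.
Qed.

Lemma op_max_eq C (N : set H) X : is_max (Mminus C N) X -> op_max (Mminus C N) = X.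
Proof.
move=> [MX hX]; rewrite /op_max /the_op; case: xgetP => [Y _ [MY hY]|/(_ X)]; last by case.
by have [sX _ _] := MX; have [sY _ _] := MY; apply: op_le_anti => //; [exact: hX|exact: hY].
Qed.

Lemma op_min_eq C (N : set H) X : is_min (Mplus C N) X -> op_min (Mplus C N) = X.
Proof.
move=> [MX hX]; rewrite /op_min /the_op; case: xgetP => [Y _ [MY hY]|/(_ X)]; last by case.
by have [sX _ _] := MX; have [sY _ _] := MY; apply: op_le_anti => //; [exact: hY|exact: hX].
Qed.

Lemma form_shift X x t : selfadjoint X -> X t = 0 ->
  ip (X (x + t)) (x + t) = ip (X x) x.
Proof.
move=> /selfadjointE[bX sX] Xt.
by rewrite (bopD _ _ bX) Xt addr0 ipDr [ip _ t]sX Xt ip0r addr0.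
Qed.

(** A competitor Y also vanishes on T, so <Y x, x> = <Y (x + t), x + t> <= <X x, x> + |L (x + t)|^2
    for every t in T, and the last term can be made as small as desired. *)
Lemma is_max_of_form C X L T : selfadjoint C -> selfadjoint X ->
  (forall t, T t -> X t = 0) ->
  (forall x, ip (C x) x = ip (X x) x + nm (L x) ^+ 2) ->
  (forall x (e : R), 0 < e -> exists2 t, T t & nm (L (x + t)) ^+ 2 <= e) ->
  is_max (Mminus C (orthocomp T)) X.
Proof.
move=> sC sX XT hC hL; split.
  split => //; last exact/range_orthocomp.
  by apply/op_leE => // x; rewrite hC lerDl sqr_ge0.
move=> Y [sY /(op_leE sY sC) YC /(range_orthocomp _ sY) YT].
apply/op_leE => // x; apply: (@le_of_eps _ _ _ 1) => // e e0.
have [t Tt ht] := hL x e e0.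
have := YC (x + t).
by rewrite hC (form_shift x sX (XT t Tt)) (form_shift x sY (YT t Tt)); lra.
Qed.

Lemma is_min_of_form C X L T : selfadjoint C -> selfadjoint X ->
  (forall t, T t -> X t = 0) ->
  (forall x, ip (C x) x = ip (X x) x - nm (L x) ^+ 2) ->
  (forall x (e : R), 0 < e -> exists2 t, T t & nm (L (x + t)) ^+ 2 <= e) ->
  is_min (Mplus C (orthocomp T)) X.
Proof.
move=> sC sX XT hC hL; split.
  split => //; last exact/range_orthocomp.
  by apply/op_leE => // x; rewrite hC lerBlDr lerDl sqr_ge0.
move=> Y [sY /(op_leE sC sY) YC /(range_orthocomp _ sY) YT].
apply/op_leE => // x; apply: (@le_of_eps _ _ _ 1) => // e e0.
have [t Tt ht] := hL x e e0.
have := YC (x + t).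
by rewrite hC (form_shift x sX (XT t Tt)) (form_shift x sY (YT t Tt)); lra.
Qed.

Lemma le_sqrtr_of_sqr (a g c : R) : 0 <= g -> a ^+ 2 <= g ^+ 2 * c -> a <= g * Num.sqrt c.
Proof.
(* For negative c, [Num.sqrt c] is 0 and the hypothesis forces a = 0. *)
move=> g0 h; have [c0|c0] := lerP 0 c; last first.
  have : a ^+ 2 <= 0 by have := sqr_ge0 g; nra.
  rewrite le_eqVlt ltNge sqr_ge0 orbF sqrf_eq0 => /eqP ->.
  by rewrite mulr_ge0 ?sqrtr_ge0.
apply: le_trans (ler_norm _) _.
rewrite -(ler_pXn2r (n := 2)) ?nnegrE ?mulr_ge0 ?sqrtr_ge0 //.
by rewrite real_normK ?num_real // exprMn sqr_sqrtr.
Qed.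

End OperatorConstructions.

(** * Block structure of [a] along the decomposition, the converse implication and the polar
    factor *)

Section SchurComplement.
Variables (R : realType) (H : hilbertType R) (B : H -> H) (S Sp Sm : set H).
Hypotheses (HB : selfadjoint B) (HS : closed_subspace S).
Hypotheses (HSp : closed_subspace Sp) (HSm : closed_subspace Sm).
Hypothesis Hsum : orthogonal_sum B S Sp Sm.
Hypotheses (Hp : nonnegative_on B Sp) (Hm : nonpositive_on B Sm).
Implicit Types (x y z w : H).

Let P := orthoproj S.
Let P1 := orthoproj Sp.
Let P2 := orthoproj Sm.
Let a := block_a S B.
Let b := block_b S B.
Let G := op_sqrt (op_abs a).

(* The signature of the decomposition: J a = |a| and J |a| = a. *)
Let J x := P1 x - P2 x.

Lemma bounded_B : bounded_op B. Proof. exact: HB.1. Qed.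
Lemma adjoint_B : real_adjoint B B. Proof. by have /selfadjointE[] := HB. Qed.
Lemma bounded_P : bounded_op P. Proof. exact: (orthoprojP HS).1. Qed.
Lemma bounded_P1 : bounded_op P1. Proof. exact: (orthoprojP HSp).1. Qed.
Lemma bounded_P2 : bounded_op P2. Proof. exact: (orthoprojP HSm).1. Qed.
Lemma P_in x : S (P x). Proof. exact: ((orthoprojP HS).2 x).1. Qed.
Lemma P1_in x : Sp (P1 x). Proof. exact: ((orthoprojP HSp).2 x).1. Qed.
Lemma P2_in x : Sm (P2 x). Proof. exact: ((orthoprojP HSm).2 x).1. Qed.
Lemma sP : real_adjoint P P. Proof. exact: orthoproj_selfadjoint. Qed.
Lemma sP1 : real_adjoint P1 P1. Proof. exact: orthoproj_selfadjoint. Qed.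
Lemma sP2 : real_adjoint P2 P2. Proof. exact: orthoproj_selfadjoint. Qed.
Lemma PK x : P (P x) = P x. Proof. exact: orthoproj_id (P_in x). Qed.
Lemma P_id s : S s -> P s = s. Proof. exact: orthoproj_id. Qed.
Lemma P1K x : P1 (P1 x) = P1 x. Proof. exact: orthoproj_id (P1_in x). Qed.
Lemma P2K x : P2 (P2 x) = P2 x. Proof. exact: orthoproj_id (P2_in x). Qed.

Lemma Sp_sub_S s : Sp s -> S s.
Proof.
have [-> _ _] := Hsum => h; exists s => //; exists 0; last by rewrite addr0.
by have [] := HSm.
Qed.

Lemma Sm_sub_S s : Sm s -> S s.
Proof.
have [-> _ _] := Hsum => h; exists 0; first by have [] := HSp.
by exists s => //; rewrite add0r.
Qed.

Lemma P1_Sm s : Sm s -> P1 s = 0.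
Proof.
move=> h; apply: orthoproj_eq0 => // t Tt; have [_ o _] := Hsum.
by rewrite innerC o // conjc0.
Qed.

Lemma P2_Sp s : Sp s -> P2 s = 0.
Proof. by move=> h; apply: orthoproj_eq0 => // t Tt; have [_ o _] := Hsum; exact: o. Qed.

Lemma P12 x : P1 (P2 x) = 0. Proof. exact/P1_Sm/P2_in. Qed.
Lemma P21 x : P2 (P1 x) = 0. Proof. exact/P2_Sp/P1_in. Qed.

Lemma P_split x : P x = P1 x + P2 x.
Proof.
apply: (@ortho_decomp_unique _ _ S x) => //; first exact: P_in.
- exact: ((orthoprojP HS).2 x).2.
- by apply: subspaceD => //; [exact/Sp_sub_S/P1_in|exact/Sm_sub_S/P2_in].
apply/orthocompE => // s; have [-> _ _] := Hsum => -[s1 h1 [s2 h2 <-]].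
have [_ o _] := Hsum.
have e1 : ip (x - P1 x) s1 = 0 by exact: (orthocompE _ HSp).1 ((orthoprojP HSp).2 x).2 _ h1.
have e2 : ip (x - P2 x) s2 = 0 by exact: (orthocompE _ HSm).1 ((orthoprojP HSm).2 x).2 _ h2.
have e3 : ip (P1 x) s2 = 0 by rewrite /ip o //; exact: P1_in.
have e4 : ip (P2 x) s1 = 0 by rewrite ipC /ip o //; exact: P2_in.
move: e1 e2; rewrite !ipDr !ipBl !ipDl e3 e4; lra.
Qed.

Lemma B_cross x y : ip (B (P1 x)) (P2 y) = 0.
Proof. by have [_ _ o] := Hsum; rewrite /ip o //; [exact: P1_in|exact: P2_in]. Qed.

Lemma P2BP1 x : P2 (B (P1 x)) = 0.
Proof. by apply: ip_eq0 => y; rewrite sP2 B_cross. Qed.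

Lemma P1BP2 x : P1 (B (P2 x)) = 0.
Proof. by apply: ip_eq0 => y; rewrite sP1 adjoint_B ipC B_cross. Qed.

Lemma B_pos x : 0 <= ip (B (P1 x)) (P1 x).
Proof. by have := Hp (P1_in x); rewrite lecE => /andP[]. Qed.

Lemma B_neg x : ip (B (P2 x)) (P2 x) <= 0.
Proof. by have := Hm (P2_in x); rewrite lecE => /andP[]. Qed.

Lemma aE x : a x = P1 (B (P1 x)) + P2 (B (P2 x)).
Proof.
rewrite /a /block_a /= -/P !P_split (bopD _ _ bounded_B) (bopD _ _ bounded_P1) (bopD _ _ bounded_P2).
by rewrite P1BP2 P2BP1 addr0 add0r.
Qed.

Let D x := P1 (B (P1 x)) - P2 (B (P2 x)).

Lemma JD x : J (D x) = a x.
Proof.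
rewrite /J /D (bopB _ _ bounded_P1) (bopB _ _ bounded_P2) P1K P2K P12 P21 aE.
by rewrite subr0 sub0r opprK.
Qed.

Lemma Ja x : J (a x) = D x.
Proof.
by rewrite /J aE (bopD _ _ bounded_P1) (bopD _ _ bounded_P2) P1K P2K P12 P21 addr0 add0r.
Qed.

Lemma bounded_J : bounded_op J. Proof. exact: bounded_sub bounded_P1 bounded_P2. Qed.

Lemma sJ : real_adjoint J J.
Proof. by move=> x y; rewrite /J ipBl ipBr sP1 sP2. Qed.

Lemma bounded_a : bounded_op a.
Proof. exact: bounded_comp (bounded_comp bounded_P bounded_B) bounded_P. Qed.

Lemma adjoint_a : real_adjoint a a.
Proof. by move=> x y; rewrite /a /block_a /= sP adjoint_B sP. Qed.

Lemma psd_D : psd D.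
Proof.
apply/psdE; split=> [|x]; last first.
  by rewrite /D ipBl sP1 sP2; have := B_pos x; have := B_neg x; lra.
apply/selfadjointE; split.
  exact: bounded_sub (bounded_comp (bounded_comp bounded_P1 bounded_B) bounded_P1)
                     (bounded_comp (bounded_comp bounded_P2 bounded_B) bounded_P2).
by move=> x y; rewrite /D ipBl ipBr sP1 sP2 !adjoint_B sP1 sP2.
Qed.

(** [a] and [D] differ by the sign of the S- block, which disappears on squaring; [D] is positive,
    so it is the square root of a^2. *)
Lemma op_abs_a : op_abs a = D.
Proof.
rewrite /op_abs (adjointP bounded_a adjoint_a).
suff -> : a \o a = D \o D by apply/op_sqrt_unique/psd_D.
have a1 x : P1 (a x) = P1 (B (P1 x)) by rewrite aE (bopD _ _ bounded_P1) P1K P12 addr0.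
have a2 x : P2 (a x) = P2 (B (P2 x)) by rewrite aE (bopD _ _ bounded_P2) P2K P21 add0r.
have d1 x : P1 (D x) = P1 (B (P1 x)) by rewrite /D (bopB _ _ bounded_P1) P1K P12 subr0.
have d2 x : P2 (D x) = - P2 (B (P2 x)) by rewrite /D (bopB _ _ bounded_P2) P2K P21 sub0r.
apply/funext => x /=; rewrite aE [D (D x)]/D a1 a2 d1 d2.
by rewrite (bopN _ bounded_B) (bopN _ bounded_P2) opprK.
Qed.

Lemma psd_G : psd G.
Proof. by rewrite /G op_abs_a; have [] := op_sqrtP psd_D. Qed.

Lemma bounded_G : bounded_op G. Proof. exact: psd_G.1. Qed.

Lemma sG : real_adjoint G G.
Proof. by have /psdE[/selfadjointE[]] := psd_G. Qed.

Lemma GG x : G (G x) = D x.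
Proof.
by rewrite /G op_abs_a; have [_ h _] := op_sqrtP psd_D; exact: (congr1 (@^~ x) h).
Qed.

Lemma GP1 x : P1 (G x) = G (P1 x).
Proof.
rewrite /G op_abs_a; have [_ _ -> //] := op_sqrtP psd_D; first exact: bounded_P1.
by move=> y; rewrite /D (bopB _ _ bounded_P1) P1K P12 P21 P1K (bop0 bounded_B) (bop0 bounded_P2).
Qed.

Lemma GP2 x : P2 (G x) = G (P2 x).
Proof.
rewrite /G op_abs_a; have [_ _ -> //] := op_sqrtP psd_D; first exact: bounded_P2.
by move=> y; rewrite /D (bopB _ _ bounded_P2) P2K P12 P21 P2K (bop0 bounded_B) (bop0 bounded_P1).
Qed.

Lemma nm_G1 x : nm (G (P1 x)) ^+ 2 = ip (B (P1 x)) (P1 x).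
Proof.
rewrite -ip_nm -sG GG /D P21 (bop0 bounded_B) (bop0 bounded_P2) subr0 sP1 !P1K.
by [].
Qed.

Lemma nm_G2 x : nm (G (P2 x)) ^+ 2 = - ip (B (P2 x)) (P2 x).
Proof. by rewrite -ip_nm -sG GG /D P12 (bop0 bounded_B) (bop0 bounded_P1) sub0r ipNl sP2 !P2K. Qed.

Lemma P1_le x : nm (P1 x) <= nm x.
Proof.
have := ip_CS (P1 x) x; rewrite -{1}P1K sP1 ip_nm.
have := nm_ge0 x; have := nm_ge0 (P1 x); nra.
Qed.

Lemma P2_le x : nm (P2 x) <= nm x.
Proof.
have := ip_CS (P2 x) x; rewrite -{1}P2K sP2 ip_nm.
have := nm_ge0 x; have := nm_ge0 (P2 x); nra.
Qed.

(** [G] commutes with the projections, and |G y|^2 = <D y, y> shows that it vanishes on vectors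
    orthogonal to S; hence R(G) lies in S. *)
Lemma GP x : P (G x) = G x.
Proof.
rewrite P_split GP1 GP2 -(bopD _ _ bounded_G) -P_split; apply/eqP; rewrite -subr_eq0.
rewrite -(bopB _ _ bounded_G); apply/eqP/nm_eq0/eqP; rewrite -sqrf_eq0 -ip_nm -sG GG.
have h : P (P x - x) = 0 by rewrite (bopB _ _ bounded_P) PK subrr.
have h1 : P1 (P x - x) = 0.
  by rewrite P_split (bopB _ _ bounded_P1) (bopD _ _ bounded_P1) P1K P12 addr0 subrr.
have h2 : P2 (P x - x) = 0.
  by rewrite P_split (bopB _ _ bounded_P2) (bopD _ _ bounded_P2) P2K P21 add0r subrr.
by rewrite /D h1 h2 (bop0 bounded_B) (bop0 bounded_P1) (bop0 bounded_P2) subrr ip0l.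
Qed.

Lemma block_bE x : b x = P (B (x - P x)).
Proof. by []. Qed.

Lemma bounded_b : bounded_op b.
Proof. exact: bounded_comp (bounded_comp bounded_P bounded_B) (bounded_sub (bounded_id H) bounded_P). Qed.

Lemma weakly_complementable_of_bounds X Y :
  Mminus B (orthocomp Sp) X -> Mplus B (orthocomp Sm) Y -> weakly_complementable S B.
Proof.
move=> [sX XB /(range_orthocomp _ sX) XT] [sY BY /(range_orthocomp _ sY) YT].
have /selfadjointE[bX aX] := sX; have /selfadjointE[bY aY] := sY.
move=> _ [x _ <-]; rewrite -/b -/a -/G; pose w := x - P x.
(* These constants may depend on x: the range inclusion is tested one vector b x at a time. *)
pose c1 := Num.sqrt (ip (B w - X w) w); pose c2 := Num.sqrt (ip (Y w - B w) w).
have h1 y : ip (P1 y) (B w) <= nm (G y) * c1.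
  apply: le_sqrtr_of_sqr; first exact: nm_ge0.
  have X0 : X (P1 y) = 0 by apply/XT/P1_in.
  (* [X] vanishes on S+, so it can be inserted freely. Cauchy-Schwarz for B - X then leaves <B P1 y,
     P1 y> = |G P1 y|^2 = |P1 G y|^2 <= |G y|^2. *)
  have -> : ip (P1 y) (B w) = ip ((B \- X) (P1 y)) w by rewrite /= X0 subr0 adjoint_B.
  apply: le_trans (psd_CS _ _ XB) _; rewrite ler_wpM2r //; first by have /psdE[] := XB.
  rewrite /= X0 subr0 -nm_G1 -GP1 ler_pXn2r ?nnegrE ?nm_ge0 //; exact: P1_le.
have h2 y : ip (P2 y) (B w) <= nm (G y) * c2.
  apply: le_sqrtr_of_sqr; first exact: nm_ge0.
  have Y0 : Y (P2 y) = 0 by apply/YT/P2_in.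
  have -> : ip (P2 y) (B w) = - ip ((Y \- B) (P2 y)) w.
    by rewrite /= Y0 sub0r ipNl opprK adjoint_B.
  rewrite sqrrN.
  apply: le_trans (psd_CS _ _ BY) _; rewrite ler_wpM2r //; first by have /psdE[] := BY.
  rewrite /= Y0 sub0r ipNl -nm_G2 -GP2 ler_pXn2r ?nnegrE ?nm_ge0 //; exact: P2_le.
have [|z _ Gz] := @douglas_range _ _ G (b x) (c1 + c2) bounded_G sG; last by exists z.
move=> y; rewrite block_bE -sP P_split ipDl mulrC mulrDr.
exact: lerD (h1 y) (h2 y).
Qed.

(** [a] kills the complement of S, so vectors orthogonal to N(a) lie in S, where [J] is a
    reflection. *)
Lemma J_isometric y : orthocomp (nullspace a) y -> nm (J y) = nm y.
Proof.
move=> hy; apply/eqP; rewrite -(eqrXn2 (n := 2)) ?nm_ge0 //; apply/eqP.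
have Py : P y = y.
  apply/eqP; rewrite eq_sym -subr_eq0; apply/eqP/nm_eq0/eqP; rewrite -sqrf_eq0 -ip_nm.
  have -> : ip (y - P y) (y - P y) = ip y (y - P y).
    by rewrite [LHS]ipBl sP (bopB _ _ bounded_P) PK subrr ip0r subr0.
  rewrite /ip hy // /nullspace /a /block_a /= -/P (bopB _ _ bounded_P) PK subrr.
  by rewrite (bop0 bounded_B) (bop0 bounded_P).
rewrite -[in RHS]Py -!ip_nm /J P_split !(ipBl, ipBr, ipDl, ipDr).
by rewrite (sP1 y (P2 y)) (sP2 y (P1 y)) P12 P21 ip0r; lra.
Qed.

(** The witness is [J] after the projection onto the complement of N(a), which gives it the required
    nullspace. It ensures that [polar a] is a genuine polar factor and not the default zero map. *)
Lemma polar_aP : [/\ partial_isometry (polar a), a = polar a \o op_abs a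
  & nullspace (polar a) = nullspace a].
Proof.
rewrite /polar /the_op; case: xgetP => [U _ //|h].
have cN := nullspace_closed bounded_a.
pose N := orthoproj (nullspace a); pose p x := x - N x.
have [bN hN] := orthoprojP cN.
have bJp : bounded_op (J \o p) := bounded_comp bounded_J (bounded_sub (bounded_id H) bN).
have nJp x : nm (J (p x)) = nm (p x) by apply: J_isometric; exact: (hN x).2.
have kJp : nullspace (J \o p) = nullspace a.
  apply/seteqP; split => x; rewrite /nullspace /= => hx.
    have : p x = 0 by apply: nm_eq0; rewrite -nJp hx nm0.
    by move/eqP; rewrite subr_eq0 => /eqP ->; exact: (hN x).1.
  by rewrite /p /N orthoproj_id // subrr (bop0 bounded_J).
case: (h (J \o p)); split => //.
- split => // x; rewrite kJp => hx; rewrite !normE /= nJp.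
  by rewrite /p /N orthoproj_eq0 // subr0.
(* R(D) is orthogonal to N(a): if a w = 0 then D w = J a w = 0. So the projection leaves D x
   unchanged, and J D = a. *)
- rewrite op_abs_a; apply/funext => x /=; rewrite -JD /p /N orthoproj_eq0 ?subr0 //.
  have [[_ sD] _] := (psdE D).1 psd_D.
  move=> w aw; rewrite sD -Ja; have -> : a w = 0 by [].
  by rewrite (bop0 bounded_J) linear0r.
Qed.

(** * The Schur complement of a weakly complementable operator and its extremality *)

Section Complementable.
Hypothesis wc : weakly_complementable S B.

Let f := reduced_solution G b.
Let fa := adjoint f.
Let L1 x := P1 (G x + f x).
Let L2 x := P2 (G x - f x).
Let Sigma := schur S B.
Let C1 x := Sigma x - adjoint L2 (L2 x).
Let C2 x := Sigma x + adjoint L1 (L1 x).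

Lemma f_spec : [/\ bounded_op f, b = G \o f, nullspace f = nullspace b
  & range f `<=` closure (range G)].
Proof. exact: reduced_solutionP bounded_G sG bounded_b wc. Qed.

Lemma bounded_f : bounded_op f. Proof. by have [] := f_spec. Qed.

Lemma Gf x : G (f x) = b x.
Proof. by have [_ h _ _] := f_spec; rewrite h. Qed.

Lemma f_closure x : closure (range G) (f x).
Proof. by have [_ _ _] := f_spec; apply; exists x. Qed.

Lemma f_S s : S s -> f s = 0.
Proof.
move=> Ss; have [_ _ h _] := f_spec.
suff : nullspace f s by [].
by rewrite h /nullspace /= block_bE (P_id Ss) subrr (bop0 bounded_B) (bop0 bounded_P).
Qed.

(** For K = u - J one has K D = a - a = 0, so |G K* y|^2 = <K D K* y, y> = 0. Thus K* maps into
    N(G), which is orthogonal to f x, and K f x = 0. *)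
Lemma polar_f x : polar a (f x) = J (f x).
Proof.
have [[bU _] hU _] := polar_aP.
have bK := bounded_sub bU bounded_J.
have [K' hK] := adjoint_exists bK.
have GK y : G (K' y) = 0.
  apply/nm_eq0/eqP; rewrite -sqrf_eq0 -ip_nm -sG GG -hK /=.
  have -> : polar a (D (K' y)) = a (K' y).
    by rewrite [in RHS]hU op_abs_a.
  by rewrite JD subrr ip0l.
apply/eqP; rewrite -subr_eq0; apply/eqP/ip_eq0 => y.
have /= -> := hK (f x) y.
exact: closure_range_ortho sG (@f_closure x) (GK y).
Qed.

Lemma adjoint_f : real_adjoint f fa. Proof. exact: adjoint_spec bounded_f. Qed.

Lemma SigmaE x : Sigma x =
  (B (x - P x) - P (B (x - P x))) - fa (J (f x)).
Proof. by rewrite /Sigma /schur /block_c /= -/P -/a -/b -/G -/f polar_f. Qed.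

Lemma selfadjoint_Sigma : selfadjoint Sigma.
Proof.
have bq := bounded_sub (bounded_id H) bounded_P.
have sq : real_adjoint (@id H \- P) (@id H \- P).
  by move=> x y /=; rewrite ipBl ipBr sP.
have -> : Sigma = ((id \- P) \o B \o (id \- P)) \- (fa \o J \o f).
  by apply/funext => x; rewrite SigmaE.
apply/selfadjointE; split.
  apply: bounded_sub; first exact: bounded_comp (bounded_comp bq bounded_B) bq.
  exact: bounded_comp (bounded_comp (bounded_adjoint bounded_f adjoint_f) bounded_J) bounded_f.
move=> x y.
have := sq (B ((id \- P) x)) y; have := sq x (B ((id \- P) y)).
have := adjoint_B ((id \- P) x) ((id \- P) y) => /= h1 h2 h3.
rewrite ipBl ipBr h3 h1 h2; congr (_ - _).
by rewrite (real_adjointC adjoint_f) sJ adjoint_f.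
Qed.

Lemma Sigma_S s : S s -> Sigma s = 0.
Proof.
move=> Ss; rewrite SigmaE f_S // (P_id Ss) subrr (bop0 bounded_B).
by rewrite (bop0 bounded_J) (bop0 (bounded_adjoint bounded_f adjoint_f)) (bop0 bounded_P) !subrr.
Qed.

Lemma B_form x : ip (B x) x = ip (Sigma x) x + nm (L1 x) ^+ 2 - nm (L2 x) ^+ 2.
Proof.
pose w := x - P x; have xE : x = P x + w by rewrite /w addrC subrK.
have e1 : ip (B (P x)) (P x) = nm (P1 (G x)) ^+ 2 - nm (P2 (G x)) ^+ 2.
  rewrite GP1 GP2 nm_G1 nm_G2 opprK -sP.
  by have -> : P (B (P x)) = P1 (B (P1 x)) + P2 (B (P2 x)); [exact: aE|rewrite ipDl sP1 sP2].
(* The cross term is governed by [b] = G f, which brings it to the same form as the mixed terms of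
   the two squares. *)
have e2 : ip (B w) (P x) = ip (G x) (f x) by rewrite -sP -[P (B w)]block_bE -Gf sG ipC.
have e3 : ip (B x) x = ip (B (P x)) (P x) + 2 * ip (B w) (P x) + ip (B w) w.
  have gen u v : ip (B (u + v)) (u + v) = ip (B u) u + 2 * ip (B v) u + ip (B v) v.
    by rewrite (bopD _ _ bounded_B) ipDl !ipDr (adjoint_B u v) (ipC u); ring.
  by rewrite -gen -xE.
have e4 : ip (Sigma x) x = ip (B w) w - ip (J (f x)) (f x).
  by rewrite SigmaE ipBl ipBl sP -/w -ipBr (real_adjointC adjoint_f).
have e5 : nm (L1 x) ^+ 2
    = nm (P1 (G x)) ^+ 2 + 2 * ip (P1 (G x)) (f x) + ip (P1 (f x)) (f x).
  have PP u v : ip (P1 u) (P1 v) = ip (P1 u) v by rewrite -sP1 P1K.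
  by rewrite /L1 (bopD _ _ bounded_P1) nm_sqD PP -[nm (P1 (f x)) ^+ 2]ip_nm PP.
have e6 : nm (L2 x) ^+ 2
    = nm (P2 (G x)) ^+ 2 - 2 * ip (P2 (G x)) (f x) + ip (P2 (f x)) (f x).
  have PP u v : ip (P2 u) (P2 v) = ip (P2 u) v by rewrite -sP2 P2K.
  by rewrite /L2 (bopB _ _ bounded_P2) nm_sqB PP -[nm (P2 (f x)) ^+ 2]ip_nm PP.
have e7 : ip (G x) (f x) = ip (P1 (G x)) (f x) + ip (P2 (G x)) (f x).
  by rewrite -ipDl -P_split GP.
by rewrite e3 e1 e2 e4 e5 e6 e7 /J ipBl; ring.
Qed.

Lemma L1_small x (e : R) : 0 < e -> exists2 t, Sp t & nm (L1 (x + t)) ^+ 2 <= e.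
Proof.
move=> e0; have q0 : 0 < Num.sqrt e by rewrite sqrtr_gt0.
have /closureP/(_ _ q0)[_ [y _ <-] hy] := @f_closure x.
(* Moving by -P1 x cancels the G x part of [L1], and -P1 y puts -P1 G y against P1 f x, where G y
   was chosen close to f x. The shift lies in S, so [f] does not see it. *)
exists (- P1 (x + y)); first by rewrite -scaleN1r; apply: subspaceZ => //; exact: P1_in.
have -> : L1 (x - P1 (x + y)) = P1 (f x - G y).
  rewrite /L1 (bopB _ _ bounded_f) (f_S (Sp_sub_S (P1_in _))) subr0 (bopB _ _ bounded_G) -GP1.
  rewrite (bopD _ _ bounded_P1) (bopB _ _ bounded_P1) P1K (bopB _ _ bounded_P1) (bopD _ _ bounded_G) (bopD _ _ bounded_P1).
  by rewrite opprD addrA subrr sub0r addrC.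
rewrite -[leRHS](sqr_sqrtr (ltW e0)) ler_pXn2r ?nnegrE ?nm_ge0 ?sqrtr_ge0 //.
by rewrite (le_trans (P1_le _)) // ltW.
Qed.

Lemma L2_small x (e : R) : 0 < e -> exists2 t, Sm t & nm (L2 (x + t)) ^+ 2 <= e.
Proof.
move=> e0; have q0 : 0 < Num.sqrt e by rewrite sqrtr_gt0.
have /closureP/(_ _ q0)[_ [y _ <-] hy] := @f_closure x.
(* The sign of y is reversed because [f] enters [L2] with a minus sign. *)
exists (- P2 (x - y)); first by rewrite -scaleN1r; apply: subspaceZ => //; exact: P2_in.
have -> : L2 (x - P2 (x - y)) = - P2 (f x - G y).
  rewrite /L2 (bopB _ _ bounded_f) (f_S (Sm_sub_S (P2_in _))) subr0 (bopB _ _ bounded_G) -GP2.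
  rewrite !(bopB _ _ bounded_P2) P2K (bopB _ _ bounded_G) (bopB _ _ bounded_P2).
  by rewrite subKr opprB.
rewrite nmN -[leRHS](sqr_sqrtr (ltW e0)) ler_pXn2r ?nnegrE ?nm_ge0 ?sqrtr_ge0 //.
by rewrite (le_trans (P2_le _)) // ltW.
Qed.

Lemma bounded_L1 : bounded_op L1.
Proof. exact: bounded_comp bounded_P1 (bounded_add bounded_G bounded_f). Qed.

Lemma bounded_L2 : bounded_op L2.
Proof. exact: bounded_comp bounded_P2 (bounded_sub bounded_G bounded_f). Qed.

(** Since [f] vanishes on S and P1 G = G P1, [L1] ignores S-. This lets L1* L1 be added to Sigma
    while the range of [C2] stays orthogonal to S-. *)
Lemma L1_Sm s : Sm s -> L1 s = 0.
Proof.
by move=> h; rewrite /L1 (f_S (Sm_sub_S h)) addr0 GP1 P1_Sm // (bop0 bounded_G).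
Qed.

Lemma L2_Sp s : Sp s -> L2 s = 0.
Proof.
by move=> h; rewrite /L2 (f_S (Sp_sub_S h)) subr0 GP2 P2_Sp // (bop0 bounded_G).
Qed.

Lemma C1_form x : ip (C1 x) x = ip (Sigma x) x - nm (L2 x) ^+ 2.
Proof. by rewrite /C1 ipBl (real_adjointC (adjoint_spec bounded_L2)) ip_nm. Qed.

Lemma C2_form x : ip (C2 x) x = ip (Sigma x) x + nm (L1 x) ^+ 2.
Proof. by rewrite /C2 ipDl (real_adjointC (adjoint_spec bounded_L1)) ip_nm. Qed.

Lemma selfadjoint_C1 : selfadjoint C1.
Proof.
have /selfadjointE[bS aS] := selfadjoint_Sigma; have h := adjoint_spec bounded_L2.
apply/selfadjointE; split.
  exact: bounded_sub bS (bounded_comp (bounded_adjoint bounded_L2 h) bounded_L2).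
by move=> x y; rewrite /C1 ipBl ipBr aS (real_adjointC h) h.
Qed.

Lemma selfadjoint_C2 : selfadjoint C2.
Proof.
have /selfadjointE[bS aS] := selfadjoint_Sigma; have h := adjoint_spec bounded_L1.
apply/selfadjointE; split.
  exact: bounded_add bS (bounded_comp (bounded_adjoint bounded_L1 h) bounded_L1).
by move=> x y; rewrite /C2 ipDl ipDr aS (real_adjointC h) h.
Qed.

Lemma C1_Sp s : Sp s -> C1 s = 0.
Proof.
move=> h; rewrite /C1 (Sigma_S (Sp_sub_S h)) L2_Sp // sub0r.
by rewrite (bop0 (bounded_adjoint bounded_L2 (adjoint_spec bounded_L2))) oppr0.
Qed.

Lemma C2_Sm s : Sm s -> C2 s = 0.
Proof.
move=> h; rewrite /C2 (Sigma_S (Sm_sub_S h)) L1_Sm // add0r.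
exact: bop0 (bounded_adjoint bounded_L1 (adjoint_spec bounded_L1)).
Qed.

(** The forms of [B] and [C1] differ by |L1 x|^2, which is small along S+; the term |L2 x|^2 is
    absorbed in [C1], as [L2] vanishes on S+. *)
Lemma max_C1 : is_max (Mminus B (orthocomp Sp)) C1.
Proof.
apply: (is_max_of_form HB selfadjoint_C1 C1_Sp _ L1_small) => x.
by rewrite B_form C1_form; ring.
Qed.

Lemma min_C2 : is_min (Mplus B (orthocomp Sm)) C2.
Proof.
apply: (is_min_of_form HB selfadjoint_C2 C2_Sm _ L2_small) => x.
by rewrite B_form C2_form; ring.
Qed.

Lemma min_Sigma : is_min (Mplus C1 (orthocomp Sm)) Sigma.
Proof.
apply: (is_min_of_form selfadjoint_C1 selfadjoint_Sigma _ _ L2_small) => [s /Sm_sub_S|x].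
  exact: Sigma_S.
exact: C1_form.
Qed.

Lemma max_Sigma : is_max (Mminus C2 (orthocomp Sp)) Sigma.
Proof.
apply: (is_max_of_form selfadjoint_C2 selfadjoint_Sigma _ _ L1_small) => [s /Sp_sub_S|x].
  exact: Sigma_S.
exact: C2_form.
Qed.

Lemma schur_extremal : exists C1 C2, [/\ is_max (Mminus B (orthocomp Sp)) C1,
    is_min (Mplus C1 (orthocomp Sm)) (schur S B),
    is_min (Mplus B (orthocomp Sm)) C2
  & is_max (Mminus C2 (orthocomp Sp)) (schur S B)].
Proof.
exists C1, C2; split; [exact: max_C1|exact: min_Sigma|exact: min_C2|exact: max_Sigma].
Qed.

End Complementable.

End SchurComplement.

(** * The equivalence and the two nested extremal formulas *)

Unset Implicit Arguments.

Theorem theorem3p4 (R : realType) (H : hilbertType R) (Hsep : separable_space H)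
    (B : H -> H) (S Sp Sm : set H)
    (HB : selfadjoint B) (HS : closed_subspace S)
    (HSp : closed_subspace Sp) (HSm : closed_subspace Sm)
    (Hsum : orthogonal_sum B S Sp Sm)
    (Hp : nonnegative_on B Sp) (Hm : nonpositive_on B Sm) :
  (weakly_complementable S B <->
     (has_max (Mminus B (orthocomp Sp)) /\
      has_min (Mplus (op_max (Mminus B (orthocomp Sp))) (orthocomp Sm))) /\
     (has_min (Mplus B (orthocomp Sm)) /\
      has_max (Mminus (op_min (Mplus B (orthocomp Sm))) (orthocomp Sp)))) /\
  (weakly_complementable S B ->
     schur S B
       = op_min (Mplus (op_max (Mminus B (orthocomp Sp))) (orthocomp Sm)) /\
     op_min (Mplus (op_max (Mminus B (orthocomp Sp))) (orthocomp Sm))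
       = op_max (Mminus (op_min (Mplus B (orthocomp Sm))) (orthocomp Sp))).
Proof.
have extremal := @schur_extremal R H B S Sp Sm HB HS HSp HSm Hsum Hp Hm.
split; [split|].
- move=> /extremal[C1 [C2 [h1 h2 h3 h4]]].
  (* Extrema are unique by antisymmetry, so the chosen inner extrema are C1 and C2. *)
  rewrite (op_max_eq h1) (op_min_eq h3).
  by split; split; [exists C1|exists (schur S B)|exists C2|exists (schur S B)].
(* The inner maximum X and the inner minimum Y supply the one-sided bounds on S+ and S-. *)
- move=> [[[X [hX _]] _] [[Y [hY _]] _]].
  exact: weakly_complementable_of_bounds hX hY.
- move=> /extremal[C1 [C2 [h1 h2 h3 h4]]].
  rewrite (op_max_eq h1) (op_min_eq h3).
  by rewrite (op_min_eq h2) (op_max_eq h4).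
Qed.
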